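(* Let $\lambda \geq 1$, $\mu \geq 0$, $\delta \geq 0$, $t\in\left(\tfrac12,1\right)$ and $\xi=\frac{2\lambda+\mu}{2\lambda+1}$. Let $f(z)=z+\sum_{n=2}^{\infty}a_n z^n$ belong to the class $\mathscr{B}_{\Sigma}^{\mu}(\lambda,\delta,t)$ defined below. Put \[ D:=(\lambda+\mu+2\xi\delta)^2-2\left[2(\lambda+\mu+2\xi\delta)^2-\big((2\lambda+\mu)(\mu+1)+12\xi\delta\big)\right]t^{2},\qquad M:=\frac{|D|}{4(2\lambda+\mu+6\xi\delta)t^{2}}. \] Then for each real number $\eta$, \[ |a_{3}-\eta a_{2}^{2}|\leq \begin{cases} \dfrac{2t}{2\lambda +\mu+6\xi\delta}, & |\eta -1|\leq M,\\[2mm] \dfrac{8|\eta -1|t^{3}}{|D|}, & |\eta -1|\geq M. \end{cases} \]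
   Context: Let $\mathbb{U}=\{z\in\mathbb{C}:|z|<1\}$ and let $\mathcal{A}$ be the class of analytic functions $f$ on $\mathbb{U}$ with $f(0)=0$, $f'(0)=1$, i.e. $f(z)=z+\sum_{n\ge2}a_nz^n$. A function $f\in\mathcal{A}$ is bi-univalent if $f$ is univalent on $\mathbb{U}$ and its inverse $g=f^{-1}$ (defined near $0$, with $f^{-1}(f(z))=z$, and $g(w)=w-a_2w^2+(2a_2^2-a_3)w^3-\cdots$) extends to a univalent function on $\mathbb{U}$; $\Sigma$ denotes the class of such $f$. For analytic $F,G$ on $\mathbb{U}$, $F\prec G$ (subordination) means there is an analytic $\omega$ on $\mathbb{U}$ with $\omega(0)=0$, $|\omega(z)|<1$ and $F=G\circ\omega$. The Chebyshev polynomials of the second kind are $U_0(t)=1$, $U_1(t)=2t$, $U_{n+1}(t)=2tU_n(t)-U_{n-1}(t)$, with generating function $H(z,t)=\frac{1}{1-2tz+z^2}=\sum_{n\ge0}U_n(t)z^n$. For $\lambda\ge1,\mu\ge0,\delta\ge0$, $t\in(\frac12,1)$ and $\xi=\frac{2\lambda+\mu}{2\lambda+1}$, the class $\mathscr{B}_{\Sigma}^{\mu}(\lambda,\delta,t)$ consists of all $f\in\Sigma$ such that, with $g=f^{-1}$, \[ (1-\lambda)\left(\tfrac{f(z)}{z}\right)^{\mu}+\lambda f'(z)\left(\tfrac{f(z)}{z}\right)^{\mu-1}+\xi\delta z f''(z)\prec H(z,t) \] and \[ (1-\lambda)\left(\tfrac{g(w)}{w}\right)^{\mu}+\lambda g'(w)\left(\tfrac{g(w)}{w}\right)^{\mu-1}+\xi\delta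 w g''(w)\prec H(w,t), \] where powers are taken with the principal branch equal to $1$ at the origin. *)

(* Defs.v *)
From HB Require Import structures.
From mathcomp Require Import all_boot all_order all_algebra.
From mathcomp Require Import complex.
From mathcomp Require Import all_classical all_reals all_analysis.
Import Order.TTheory GRing.Theory Num.Theory.
Import numFieldNormedType.Exports.

Set Implicit Arguments.
Unset Strict Implicit.
Unset Printing Implicit Defensive.

Local Open Scope ring_scope.

(* The complex numbers R[i] carry the norm topology of the numeric field
   R[i] (|x +i* y| = sqrt (x^2 + y^2)), and are a normed module over
   themselves, so that [derivable f z 1] / [derive1 f] are *complex*
   differentiability / the complex derivative. *)
Section ComplexNormedModule.
Variable R : rcfType.
HB.instance Definition _ := PseudoPointedMetric.copy R[i] R[i]^o.
HB.instance Definition _ := GRing.ComAlgebra.copy R[i] R[i]^o.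
HB.instance Definition _ := Vector.copy R[i] R[i]^o.
HB.instance Definition _ := NormedModule.copy R[i] R[i]^o.
End ComplexNormedModule.

Section Defs.
Variable R : realType.
Local Notation C := R[i].

Definition analytic_U (f : C -> C) : Prop :=
  forall z : C, `|z| < 1 -> derivable f z 1.

Definition univalent_U (f : C -> C) : Prop :=
  analytic_U f /\
  (forall z w : C, `|z| < 1 -> `|w| < 1 -> f z = f w -> z = w).

Definition classA (f : C -> C) : Prop :=
  analytic_U f /\ f 0 = 0 /\ derive1 f 0 = 1.

Definition inverse_extension (f g : C -> C) : Prop :=
  univalent_U g /\ \forall z \near (0 : C), g (f z) = z.

Definition bi_univalent (f : C -> C) : Prop :=
  classA f /\ univalent_U f /\ exists g, inverse_extension f g.

Definition cexp (z : C) : C :=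
  ((expR (complex.Re z))%:C * (cos (complex.Im z) +i* sin (complex.Im z)))%C.

(* L is the branch of log (h(z)/z) on U with L(0) = 0 (so that
   (h(z)/z)^p := cexp (p * L z) is the branch equal to 1 at the origin) *)
Definition log_quot (h L : C -> C) : Prop :=
  analytic_U L /\ L 0 = 0 /\
  (forall z : C, `|z| < 1 -> z != 0 -> cexp (L z) = h z / z).

Definition subordinate (F G : C -> C) : Prop :=
  exists w : C -> C, analytic_U w /\ w 0 = 0 /\
    (forall z : C, `|z| < 1 -> `|w z| < 1) /\
    (forall z : C, `|z| < 1 -> F z = G (w z)).

(* generating function of the Chebyshev polynomials of the second kind *)
Definition Hcheb (t : R) (z : C) : C := (1 - 2%:R * t%:C%C * z + z ^+ 2)^-1.

Definition xi (lam mu : R) : R := (2%:R * lam + mu) / (2%:R * lam + 1).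

(* (1-λ)(h/z)^μ + λ h'(z) (h/z)^(μ-1) + ξ δ z h''(z), powers via the branch L *)
Definition Phi (lam mu del : R) (h L : C -> C) (z : C) : C :=
  (1 - lam%:C%C) * cexp (mu%:C%C * L z)
  + lam%:C%C * derive1 h z * cexp ((mu%:C%C - 1) * L z)
  + (xi lam mu * del)%:C%C * z * derive1n 2 h z.

Definition classB (lam mu del t : R) (f : C -> C) : Prop :=
  classA f /\ univalent_U f /\
  exists g : C -> C, inverse_extension f g /\
    (exists Lf, log_quot f Lf /\ subordinate (Phi lam mu del f Lf) (Hcheb t)) /\
    (exists Lg, log_quot g Lg /\ subordinate (Phi lam mu del g Lg) (Hcheb t)).

Definition coef2 (f : C -> C) : C := derive1n 2 f 0 / 2%:R.
Definition coef3 (f : C -> C) : C := derive1n 3 f 0 / 6%:R.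

Definition Dquant (lam mu del t : R) : R :=
  let A := lam + mu + 2%:R * xi lam mu * del in
  A ^+ 2 - 2%:R * (2%:R * A ^+ 2
     - ((2%:R * lam + mu) * (mu + 1) + 12%:R * xi lam mu * del)) * t ^+ 2.

Definition Mquant (lam mu del t : R) : R :=
  `|Dquant lam mu del t| /
    (4%:R * (2%:R * lam + mu + 6%:R * xi lam mu * del) * t ^+ 2).

End Defs.

(* Main.v *)
(* Comparing coefficients of z and z^2 in the two subordinations gives, with
   A = lam + mu + 2 xi del, B = 2 lam + mu + 6 xi del, Q = (mu - 1)(2 lam + mu)/2
   and Schwarz functions w = c1 z + c2 z^2 + ..., d1 z + d2 z^2 + ...:
     A a2 = 2 t c1,    B a3 + Q a2^2 = 2 t c2 + (4 t^2 - 1) c1^2,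
     - A a2 = 2 t d1,  B (2 a2^2 - a3) + Q a2^2 = 2 t d2 + (4 t^2 - 1) d1^2.
   Hence d1 = - c1, D a2^2 = 4 t^3 (c2 + d2) and B (a3 - a2^2) = t (c2 - d2), so that
     a3 - eta a2^2 = (h + k) c2 + (h - k) d2,  h = 4 t^3 (1 - eta) / D,  k = t / B,
   and |c2|, |d2| <= 1 bounds this by 2 max(|h|, k).
   Second and third derivatives exist by the Cauchy formula, which follows from
   Goursat's quadrisection argument with one exceptional point allowed; this
   exception lets the theorem be applied to difference quotients.  Integrals of
   curves are increments of a primitive. *)
Require Import Defs.
From HB Require Import structures.
From mathcomp Require Import all_boot all_order all_algebra.
From mathcomp Require Import complex.
From mathcomp Require Import all_classical all_reals all_analysis.
From mathcomp Require Import ring lra.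
Import Order.TTheory GRing.Theory Num.Theory.
Import numFieldNormedType.Exports.
Local Open Scope ring_scope.

Set Implicit Arguments.
Unset Strict Implicit.
Unset Printing Implicit Defensive.

(** The norm of [R[i]] takes its values in [R[i]] itself, so all estimates use the real modulus
    [nm], and derivatives are put into a quotient-free epsilon-delta form that also covers curves.
    The branch of the logarithm is never computed: only its expansion to order 2 matters, and
    [cexp (L z) = h z / z] determines it. The bound |c2| <= 1 comes from a circle mean: r^2 c2 is
    the average of w(r e^(it)) e^(-2it), and r tends to 1. The function (w - c1 z - c2 z^2) / z^3
    has its exceptional point at 0, which is a second use of the exception in Goursat's theorem. The
    bound 2 max(|h|, k) rests on |h + k| + |h - k| = 2 max(|h|, k), and M is the threshold between
    the two cases because |h| / k = |eta - 1| / M. If D = 0 then h makes no sense, but M = 0 as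
    well, so the first case only concerns eta = 1, where a2 drops out. *)

Local Notation nm := Normc.normc.

(** * Complex modulus and derivatives *)

Section Modulus.
Variable R : realType.
Local Notation C := R[i].
Implicit Types z w : C.

Lemma norm_normc z : `|z| = (nm z)%:C%C.
Proof. by rewrite normc_def; case: z. Qed.

Lemma normc_ge0 z : 0 <= nm z.
Proof. by case: z => a b; rewrite sqrtr_ge0. Qed.

Lemma normcB z w : nm (z - w) = nm (w - z).
Proof. by rewrite -normcN opprB. Qed.

Lemma normc_real (x : R) : nm x%:C%C = `|x|.
Proof. by rewrite /= expr0n addr0 sqrtr_sqr. Qed.

Lemma normc_gt0 z : z != 0 -> 0 < nm z.
Proof.
move=> z0; rewrite lt_neqAle normc_ge0 andbT eq_sym.
by apply: contra z0 => /eqP /Normc.eq0_normc ->.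
Qed.

Lemma le_normc_sub z w : nm z - nm w <= nm (z - w).
Proof. by rewrite lerBlDr -{1}[z](subrK w) le_normcD. Qed.

Lemma normcX z n : nm (z ^+ n) = nm z ^+ n.
Proof.
by elim: n => [|n IH]; rewrite ?expr0 ?Normc.normc1// !exprS Normc.normcM IH.
Qed.

Lemma normc_sqr (x y : R) : nm (x +i* y)%C ^+ 2 = x ^+ 2 + y ^+ 2.
Proof. by rewrite /= sqr_sqrtr ?addr_ge0 ?sqr_ge0. Qed.

Lemma normc_ltE (x y r : R) : 0 <= r ->
  (nm (x +i* y)%C < r) = (x ^+ 2 + y ^+ 2 < r ^+ 2).
Proof.
by move=> r0; rewrite -normc_sqr ltr_sqr// nnegrE normc_ge0.
Qed.

Lemma ge_Re_normc z : `|complex.Re z| <= nm z.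
Proof.
by case: z => a b; rewrite -sqrtr_sqr ler_wsqrtr ?lerDl ?sqr_ge0.
Qed.

Lemma ge_Im_normc z : `|complex.Im z| <= nm z.
Proof.
by case: z => a b; rewrite -sqrtr_sqr ler_wsqrtr ?lerDr ?sqr_ge0.
Qed.

Lemma normc_le_add (x y : R) : nm (x +i* y)%C <= `|x| + `|y|.
Proof.
have -> : (x +i* y)%C = x%:C%C + 'i%C * y%:C%C by rewrite {1}[(_ +i* _)%C]complexE.
apply: (le_trans (le_normcD _ _)).
by rewrite Normc.normcM !normc_real /= expr0n expr1n add0r sqrtr1 mul1r.
Qed.

Lemma ReB z w : complex.Re (z - w) = complex.Re z - complex.Re w.
Proof. by case: z; case: w. Qed.

Lemma ImB z w : complex.Im (z - w) = complex.Im z - complex.Im w.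
Proof. by case: z; case: w. Qed.

Lemma ReMr z (x : R) : complex.Re (z * x%:C%C) = complex.Re z * x.
Proof. by case: z => a b; rewrite /= mulr0 subr0. Qed.

Lemma ImMr z (x : R) : complex.Im (z * x%:C%C) = complex.Im z * x.
Proof. by case: z => a b; rewrite /= mulr0 add0r. Qed.

Lemma normc_i : nm ('i%C : C) = 1.
Proof. by rewrite /= expr0n expr1n add0r sqrtr1. Qed.

Lemma normc_eq0P z : (forall e, 0 < e -> nm z <= e) -> z = 0.
Proof.
move=> h; apply: Normc.eq0_normc; apply/eqP; rewrite eq_le normc_ge0 andbT.
by apply/ler_addgt0Pl => e e0; rewrite addr0 h.
Qed.

End Modulus.

(* The parameter [i] embeds the source into the complex numbers: [id] gives
   complex derivatives and [real_complex] derivatives of curves. *)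
Section Derivation.
Variables (R : realType) (T : Type) (i : T -> R[i]).
Local Notation C := R[i].
Implicit Types f g : T -> C.

Definition vanishing z f := forall e, 0 < e ->
  exists2 d, 0 < d & forall w, nm (i w - i z) < d -> nm (f w) <= e.

(** This is f w = o(i w - i z), without a quotient: w = z needs no exception, and there the
    condition says f z = 0. *)
Definition negligible z f := forall e, 0 < e ->
  exists2 d, 0 < d & forall w, nm (i w - i z) < d ->
    nm (f w) <= e * nm (i w - i z).

Definition der f z l := negligible z (fun w => f w - f z - l * (i w - i z)).

Lemma eq_negligible z f g : negligible z f -> f =1 g -> negligible z g.
Proof. by move=> h /funext <-. Qed.

Lemma negligibleD z f g :
  negligible z f -> negligible z g -> negligible z (fun w => f w + g w).
Proof.
move=> hf hg e e0; have e2 : 0 < e / 2 by lra.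
have [d d0 h] := hf _ e2; have [d' d'0 h'] := hg _ e2.
exists (Num.min d d') => [|w]; first by rewrite lt_min d0.
rewrite lt_min => /andP[/h hw /h' hw'].
by apply: le_trans (le_normcD _ _) _; lra.
Qed.

Lemma negligibleM z f (b : T -> C) M : negligible z f ->
  (exists2 d, 0 < d & forall w, nm (i w - i z) < d -> nm (b w) <= M) ->
  negligible z (fun w => f w * b w).
Proof.
move=> hf [d d0 hb] e e0.
have M0 : 0 <= M.
  by rewrite (le_trans (normc_ge0 _) (hb z _))// subrr Normc.normc0.
have e1 : 0 < e / (M + 1) by apply: divr_gt0 => //; lra.
have [d' d'0 h] := hf _ e1.
exists (Num.min d d') => [|w]; first by rewrite lt_min d0.
rewrite lt_min => /andP[/hb hw /h hw'].
rewrite Normc.normcM (le_trans (ler_pM (normc_ge0 _) (normc_ge0 _) hw' hw))//.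
rewrite mulrAC ler_wpM2r ?normc_ge0// -mulrA ger_pMr// mulrC ler_pdivrMr; lra.
Qed.

Lemma negligibleZ z f c : negligible z f -> negligible z (fun w => c * f w).
Proof.
move=> hf; apply: (@eq_negligible _ (fun w => f w * c)) => [|w]; last by rewrite mulrC.
by apply: (negligibleM (M := nm c)) => //; exists 1.
Qed.

Lemma vanishing_negligible z f :
  vanishing z f -> negligible z (fun w => f w * (i w - i z)).
Proof.
move=> hf e /hf[d d0 h]; exists d => // w /h hw.
by rewrite Normc.normcM ler_wpM2r ?normc_ge0.
Qed.

Lemma der_lipschitz f z l : der f z l -> exists2 d, 0 < d &
  forall w, nm (i w - i z) < d -> nm (f w - f z) <= (nm l + 1) * nm (i w - i z).
Proof.
move=> /(_ 1 ltr01)[d d0 h]; exists d => // w /h hw.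
rewrite -[X in nm X](subrK (l * (i w - i z))) (le_trans (le_normcD _ _))//.
by rewrite Normc.normcM; lra.
Qed.

Lemma der_vanishing f z l : der f z l -> vanishing z (fun w => f w - f z).
Proof.
move=> /der_lipschitz[d d0 h] e e0.
have l0 : 0 < nm l + 1 by have := normc_ge0 l; lra.
exists (Num.min d (e / (nm l + 1))) => [|w]; first by rewrite lt_min d0 divr_gt0.
rewrite lt_min => /andP[/h hw]; rewrite ltr_pdivlMr// mulrC => he.
by rewrite (le_trans hw)// ltW.
Qed.

Lemma eq_der f g z l : (exists2 d, 0 < d &
  forall w, nm (i w - i z) < d -> f w = g w) -> der f z l -> der g z l.
Proof.
move=> [d d0 fg] hf e /hf[d' d'0 h].
have fz : f z = g z by rewrite fg// subrr Normc.normc0.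
exists (Num.min d d') => [|w]; first by rewrite lt_min d0.
by rewrite lt_min -fz => /andP[/fg <- /h].
Qed.

Lemma der_congr f g z l m : der f z l -> f =1 g -> l = m -> der g z m.
Proof. by move=> hf /funext <- <-. Qed.

Lemma der_cst c z : der (fun=> c) z 0.
Proof.
move=> e e0; exists 1 => // w _.
by rewrite subrr mul0r subr0 Normc.normc0 mulr_ge0 ?normc_ge0// ltW.
Qed.

Lemma der_id z : der i z 1.
Proof.
move=> e e0; exists 1 => // w _.
by rewrite mul1r subrr Normc.normc0 mulr_ge0 ?normc_ge0// ltW.
Qed.

Lemma derD f g z l m : der f z l -> der g z m -> der (fun w => f w + g w) z (l + m).
Proof. by move=> hf hg; apply: eq_negligible (negligibleD hf hg) _ => w; ring. Qed.

Lemma derZ c f z l : der f z l -> der (fun w => c * f w) z (c * l).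
Proof. by move=> hf; apply: eq_negligible (negligibleZ c hf) _ => w; ring. Qed.

Lemma derB f g z l m : der f z l -> der g z m -> der (fun w => f w - g w) z (l - m).
Proof.
by move=> hf hg; apply: eq_negligible (negligibleD hf (negligibleZ (-1) hg)) _ => w; ring.
Qed.

Lemma derM f g z l m : der f z l -> der g z m ->
  der (fun w => f w * g w) z (l * g z + f z * m).
Proof.
move=> hf hg.
have n1 : negligible z (fun w => (f w - f z - l * (i w - i z)) * g w).
  have [d d0 h] := der_vanishing hg ltr01.
  apply: (negligibleM (M := nm (g z) + 1) hf); exists d => // w /h hw.
  by have := le_normc_sub (g w) (g z); lra.
have n2 := vanishing_negligible (der_vanishing hg).
apply: eq_negligible
  (negligibleD n1 (negligibleD (negligibleZ (f z) hg) (negligibleZ l n2))) _ => w.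
by ring.
Qed.

(** The hypothesis on [K] is its complex derivative at [f z] written out, because [der] is tied to
    the embedding [i] inside this section. *)
Lemma der_comp (f : T -> C) (K : C -> C) z l m :
  der f z m -> (forall e, 0 < e -> exists2 d, 0 < d & forall w, nm (w - f z) < d ->
    nm (K w - K (f z) - l * (w - f z)) <= e * nm (w - f z)) ->
  der (fun w => K (f w)) z (l * m).
Proof.
move=> hf hK.
suff n1 : negligible z (fun w => K (f w) - K (f z) - l * (f w - f z)).
  by apply: eq_negligible (negligibleD n1 (negligibleZ l hf)) _ => w; ring.
move=> e e0; have [d d0 h] := der_lipschitz hf.
have m0 : 0 < nm m + 1 by have := normc_ge0 m; lra.
have [d1 d10 h1] := hK _ (divr_gt0 e0 m0).
exists (Num.min d (d1 / (nm m + 1))) => [|w]; first by rewrite lt_min d0 divr_gt0.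
rewrite lt_min => /andP[/h hw]; rewrite ltr_pdivlMr// mulrC => hd.
rewrite (le_trans (h1 _ (le_lt_trans hw hd)))//.
by rewrite -mulrA ler_wpM2l ?(ltW e0)// ler_pdivrMl.
Qed.

End Derivation.

Local Notation cder := (@der _ _ id).
Local Notation vder := (@der _ _ (real_complex _)).

(** * Curves: mean value inequality and primitives *)

Section Bridge.

(** Stated over any [numFieldType] so that one proof serves both the real line and the complex
    plane. *)
Lemma is_deriveP (K : numFieldType) (f : K -> K) (z l : K) :
  is_derive z 1 f l <->
  forall e, 0 < e -> exists2 d, 0 < d & forall w, `|w - z| < d ->
    `|f w - f z - l * (w - z)| <= e * `|w - z|.
Proof.
have E h : h != 0 -> `|l - h^-1 *: ((f \o shift z) (h *: 1) - f z)| =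
    `|h|^-1 * `|f (h + z) - f z - l * h|.
  move=> h0; rewrite -normfV -normrM distrC /= /shift /=.
  rewrite /GRing.scale /= mulr1; congr `|_|; field.
  by [].
split=> [[df dl] e e0|H].
  move: df; rewrite /derivable => /cvg_ex[/= l' hl'].
  have ll : l = l' by rewrite -dl /derive; apply: cvg_lim.
  subst l'.
  have /nbhs_ballP[d /= d0 hd] : nbhs (0 : K) (fun h => h != 0 ->
    `|l - h^-1 *: ((f \o shift z) (h *: 1) - f z)| <= e).
    exact: cvgr_dist_le hl' _ e0.
  exists d => // w wd; have [->|wz] := eqVneq w z.
    by rewrite !subrr mulr0 subrr normr0 mulr0.
  have h0 : w - z != 0 by rewrite subr_eq0.
  have := hd (w - z); rewrite /ball /= sub0r normrN => /(_ wd h0).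
  by rewrite E// subrK ler_pdivrMl ?normr_gt0// [_ * e]mulrC.
have cv : ((fun h => h^-1 *: ((f \o shift z) (h *: 1) - f z)) @ 0^' --> l)%classic.
  apply/cvgrPdist_le => e e0; have [d d0 hd] := H e e0.
  suff : nbhs (0 : K) (fun h => h != 0 ->
    `|l - h^-1 *: ((f \o shift z) (h *: 1) - f z)| <= e) by [].
  apply/nbhs_ballP; exists d => //= h; rewrite /ball /= sub0r normrN => hh h0.
  rewrite E// ler_pdivrMl ?normr_gt0// [_ * e]mulrC.
  by have := hd (h + z); rewrite addrK; apply.
by apply: DeriveDef; [apply/cvg_ex; exists l|exact: cvg_lim].
Qed.

Variable R : realType.
Local Notation C := R[i].

Lemma cderP (f : C -> C) (z l : C) : is_derive z (1 : C) f l <-> cder f z l.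
Proof.
rewrite is_deriveP; split=> H.
  move=> e e0; have [|d d0 hd] := H e%:C%C; first by rewrite ltcR.
  (* A positive element of [R[i]] is real, so radii can be moved between [R[i]] and [R]. *)
  have dr : d = (complex.Re d)%:C%C by rewrite RRe_real// gtr0_real.
  exists (complex.Re d) => [|w wd]; first by rewrite -ltcR -dr.
  by rewrite -lecR rmorphM -!norm_normc; apply: hd; rewrite norm_normc dr ltcR.
move=> e e0.
have er : e = (complex.Re e)%:C%C by rewrite RRe_real// gtr0_real.
have [|d d0 hd] := H (complex.Re e); first by rewrite -ltcR -er.
exists d%:C%C => [|w]; first by rewrite ltcR.
by rewrite er !norm_normc ltcR => /hd; rewrite -lecR rmorphM.
Qed.

Lemma derivable_cder (f : C -> C) (z : C) : derivable f z 1 -> cder f z (derive1 f z).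
Proof. by move=> /derivableP; rewrite -derive1E => /cderP. Qed.

Lemma cder_derive1 (f : C -> C) (z l : C) : cder f z l -> derive1 f z = l.
Proof. by move=> /cderP[_ <-]; rewrite derive1E. Qed.

Lemma vder_is_derive (g : R -> C) t l : vder g t l ->
  is_derive t (1 : R) (fun s => complex.Re (g s)) (complex.Re l) /\
  is_derive t (1 : R) (fun s => complex.Im (g s)) (complex.Im l).
Proof.
move=> H; split; apply/is_deriveP => e /H[d d0 hd]; exists d => // s.
  rewrite -normc_real rmorphB => /hd; rewrite -rmorphB normc_real; apply: le_trans.
  rewrite (le_trans _ (ge_Re_normc _))//.
  by rewrite !ReB ReMr.
rewrite -normc_real rmorphB => /hd; rewrite -rmorphB normc_real; apply: le_trans.
rewrite (le_trans _ (ge_Im_normc _))//.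
by rewrite !ImB ImMr.
Qed.

Lemma is_derive_vder (u v : R -> R) t a b :
  is_derive t (1 : R) u a -> is_derive t (1 : R) v b ->
  vder (fun s => u s +i* v s)%C t (a +i* b)%C.
Proof.
move=> /is_deriveP Hu /is_deriveP Hv e e0; have e2 : 0 < e / 2 by lra.
have [d d0 hd] := Hu _ e2; have [d' d'0 hd'] := Hv _ e2.
exists (Num.min d d') => [|s]; first by rewrite lt_min d0.
rewrite -rmorphB normc_real lt_min => /andP[/hd h1 /hd' h2].
have -> : ((u s +i* v s) - (u t +i* v t) - (a +i* b) * (s - t)%:C)%C =
  ((u s - u t - a * (s - t)) +i* (v s - v t - b * (s - t)))%C.
  by rewrite /GRing.add /GRing.opp /GRing.mul /= mulr0 subr0 mulr0 add0r.
by rewrite (le_trans (normc_le_add _ _))//; lra.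
Qed.

(** Multiplication by a number c of modulus 1 turns the increment of g into its own modulus; the
    real mean value theorem then applies to Re (c g). *)
Lemma vder_bound (g g' : R -> C) (a b M : R) : a <= b ->
  (forall t, a <= t <= b -> vder g t (g' t)) ->
  (forall t, a <= t <= b -> nm (g' t) <= M) ->
  nm (g b - g a) <= M * (b - a).
Proof.
move=> ab dg bg; have [->|n0] := eqVneq (g b - g a) 0.
  rewrite Normc.normc0 mulr_ge0 ?subr_ge0//.
  by rewrite (le_trans (normc_ge0 _) (bg a _))// lexx.
set D := g b - g a in n0 *; pose c := D^*%C / (nm D)%:C%C.
have nD := normc_gt0 n0.
have nD' : (nm D)%:C%C != 0 by apply: contraTneq nD => /complexI ->; rewrite ltxx.
have nc : nm c = 1.
  rewrite Normc.normcM Normc.normcV normc_real ger0_norm ?normc_ge0//.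
  have -> : nm D^*%C = nm D by apply: complexI; rewrite -!norm_normc normcJ.
  by rewrite mulfV// lt0r_neq0.
have cD : c * D = (nm D)%:C%C.
  rewrite /c mulrAC (mulrC _ D) -sqr_normc norm_normc expr2 -rmorphM.
  by rewrite rmorphM mulfK.
have dh t : a <= t <= b -> is_derive t (1 : R)
    (fun s => complex.Re (c * g s)) (complex.Re (c * g' t)).
  by move=> tab; have [] := vder_is_derive (derZ c (dg _ tab)).
have [t||t tab] := @MVT_segment _ (fun s => complex.Re (c * g s))
    (fun s => complex.Re (c * g' s)) a b ab.
- by rewrite in_itv /= => /andP[/ltW at_ /ltW tb]; apply: dh; rewrite at_.
- apply: derivable_within_continuous => t; rewrite in_itv /= => /dh [] //.
move: tab; rewrite in_itv /= => tab.
have -> : complex.Re (c * g b) - complex.Re (c * g a) = nm D.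
  by rewrite -ReB -mulrBr -/D cD.
move=> ->; rewrite ler_wpM2r ?subr_ge0//.
rewrite (le_trans (ler_norm _))// (le_trans (ge_Re_normc _))//.
by rewrite Normc.normcM nc mul1r bg.
Qed.

Lemma vder_bound_sym (g g' : R -> C) (a b M : R) :
  (forall t, Num.min a b <= t <= Num.max a b -> vder g t (g' t)) ->
  (forall t, Num.min a b <= t <= Num.max a b -> nm (g' t) <= M) ->
  nm (g b - g a) <= M * `|b - a|.
Proof.
case: (leP a b) => ab dg bg.
  by rewrite (ger0_norm (_ : 0 <= b - a)) ?subr_ge0//; exact: vder_bound ab dg bg.
rewrite distrC normcB ger0_norm ?subr_ge0 ?(ltW ab)//.
exact: vder_bound (ltW ab) dg bg.
Qed.

Lemma real_primitive (f : R -> R) (b : R) :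
  (forall t, - b <= t <= b -> {for t, continuous f}) ->
  exists F : R -> R, forall t, - b < t < b -> is_derive t (1 : R) F (f t).
Proof.
move=> fc; pose F x := (\int[lebesgue_measure]_(t in [set` `[- b, x]]) (f t))%R.
exists F => t /andP[bt tb].
have fi : lebesgue_measure.-integrable `[- b, b]%classic (EFin \o f).
  apply: continuous_compact_integrable; first exact: segment_compact.
  apply: continuous_in_subspaceT => x; rewrite inE /= in_itv /= => xb.
  exact: fc.
have [|dF Ft] := @continuous_FTC1_closed _ f (- b) t b tb fi bt.
  by apply: fc; rewrite !ltW.
by rewrite -Ft derive1E; apply/derivableP.
Qed.

(** Continuity is asked on the closed interval, for integrability, while the derivative is obtained
    on the open one. Users therefore need some room beyond the points they care about. *)
Lemma vder_primitive (g : R -> C) (b : R) :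
  (forall t, - b <= t <= b -> vanishing (real_complex _) t (fun s => g s - g t)) ->
  exists G : R -> C, forall t, - b < t < b -> vder G t (g t).
Proof.
move=> gc.
have [|G hG] := @real_primitive (fun t => complex.Re (g t)) b.
  move=> t /gc ht; apply/cvgrPdist_le => e /ht[d d0 hd].
  apply/nbhs_ballP; exists d => //= s; rewrite /ball /= => ts.
  rewrite distrC.
  have := hd s; rewrite -rmorphB normc_real (distrC s) => /(_ ts).
  apply: le_trans; rewrite (le_trans _ (ge_Re_normc _))//.
  by rewrite ReB.
have [|H hH] := @real_primitive (fun t => complex.Im (g t)) b.
  move=> t /gc ht; apply/cvgrPdist_le => e /ht[d d0 hd].
  apply/nbhs_ballP; exists d => //= s; rewrite /ball /= => ts.
  rewrite distrC.
  have := hd s; rewrite -rmorphB normc_real (distrC s) => /(_ ts).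
  apply: le_trans; rewrite (le_trans _ (ge_Im_normc _))//.
  by rewrite ImB.
exists (fun t => G t +i* H t)%C => t tb.
have -> : g t = (complex.Re (g t) +i* complex.Im (g t))%C by case: (g t).
exact: is_derive_vder (hG _ tb) (hH _ tb).
Qed.

End Bridge.

(** * Goursat's theorem with an exceptional point *)

Section Nested.
Variable R : realType.

Lemma halving_small (A d : R) : 0 < d -> exists n, A * 2^-1 ^+ n < d.
Proof.
move=> d0; exists (Num.bound (`|A| / d)).
set n := Num.bound _; have := archi_boundP (divr_ge0 (normr_ge0 A) (ltW d0)).
rewrite -/n ltr_pdivrMr// => h.
rewrite exprVn ltr_pdivrMr ?exprn_gt0//.
apply: (le_lt_trans (ler_norm A)); apply: (lt_le_trans h).
by rewrite mulrC ler_wpM2l ?(ltW d0)// -natrX ler_nat ltnW// ltn_expl.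
Qed.

(** Every right endpoint bounds all left endpoints, so the supremum of the left endpoints lies in
    all the intervals. *)
Lemma nested_point (u w : nat -> R) :
  (forall n, u n <= u n.+1) -> (forall n, u n.+1 + w n.+1 <= u n + w n) ->
  (forall n, 0 <= w n) -> exists p, forall n, u n <= p <= u n + w n.
Proof.
move=> hu hw w0.
have /nondecreasing_seqP mu := hu.
have mw m n : (m <= n)%N -> u n + w n <= u m + w m.
  elim: n => [|n IH]; first by rewrite leqn0 => /eqP ->.
  by rewrite leq_eqVlt => /predU1P[->//|/IH]; apply: le_trans.
have ub n : ubound (range u) (u n + w n).
  move=> _ [m _ <-]; rewrite (le_trans (mu _ _ (leq_maxl m n)))//.
  by rewrite (le_trans _ (mw _ _ (leq_maxr m n)))// lerDl.
exists (sup (range u)) => n; apply/andP; split.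
  by apply: ub_le_sup; [exists (u 0 + w 0)|exists n].
by apply: ge_sup => //; exists (u 0); exists 0%N.
Qed.

End Nested.

Section Goursat.
Variables (R : realType) (f : R[i] -> R[i]) (r : R) (H V : R -> R -> R[i]).
Local Notation C := R[i].

Hypothesis hH : forall x y, x ^+ 2 + y ^+ 2 < r ^+ 2 ->
  vder (H y) x (f (x +i* y)%C).
Hypothesis hV : forall x y, x ^+ 2 + y ^+ 2 < r ^+ 2 ->
  vder (V x) y ('i%C * f (x +i* y)%C).

(** The integral of f dz along the counterclockwise boundary of the rectangle: [H y] integrates f
    along the horizontal line at height y, and [V x] integrates i f along the vertical line at
    abscissa x. *)
Definition rint x1 x2 y1 y2 :=
  H y1 x2 - H y1 x1 + (V x2 y2 - V x2 y1)
  - (H y2 x2 - H y2 x1) - (V x1 y2 - V x1 y1).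

Definition rect_in x1 x2 y1 y2 := forall x y, x1 <= x <= x2 -> y1 <= y <= y2 ->
  x ^+ 2 + y ^+ 2 < r ^+ 2.

Lemma rint_splitx x2 x1 x3 y1 y2 :
  rint x1 x3 y1 y2 = rint x1 x2 y1 y2 + rint x2 x3 y1 y2.
Proof. by rewrite /rint; ring. Qed.

Lemma rint_splity y2 x1 x2 y1 y3 :
  rint x1 x2 y1 y3 = rint x1 x2 y1 y2 + rint x1 x2 y2 y3.
Proof. by rewrite /rint; ring. Qed.

(* An affine function has the primitive [Q], so only the error term counts. *)
Lemma rint_affine_bound (a l : C) x1 x2 y1 y2 M :
  x1 <= x2 -> y1 <= y2 -> rect_in x1 x2 y1 y2 ->
  (forall x y, x1 <= x <= x2 -> y1 <= y <= y2 ->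
     nm (f (x +i* y)%C - (a + l * (x +i* y)%C)) <= M) ->
  nm (rint x1 x2 y1 y2) <= 2 * M * ((x2 - x1) + (y2 - y1)).
Proof.
move=> x12 y12 inD hM.
pose Q (z : C) := a * z + l / 2 * (z * z).
have dQ z : cder Q z (a + l * z).
  apply: der_congr (derD (derZ a (der_id id z))
    (derZ (l / 2) (derM (der_id id z) (der_id id z)))) _ _ => //.
  by field.
have cx (x y : R) : vder (fun s => (s +i* y)%C) x 1.
  by apply: (is_derive_vder (is_derive_id x 1) (is_derive_cst y x 1)).
have cy (x y : R) : vder (fun s => (x +i* s)%C) y 'i%C.
  by apply: (is_derive_vder (is_derive_cst x y 1) (is_derive_id y 1)).
have hor y : y1 <= y <= y2 ->
    nm (H y x2 - Q (x2 +i* y)%C - (H y x1 - Q (x1 +i* y)%C)) <= M * (x2 - x1).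
  move=> hy; apply: (vder_bound (g := fun x => H y x - Q (x +i* y)%C)
    (g' := fun x => f (x +i* y)%C - (a + l * (x +i* y)%C) * 1)) => // x hx.
    by apply: (derB (hH (inD x y hx hy)) (der_comp (cx x y) (dQ _))).
  by rewrite mulr1; apply: hM.
have ver x : x1 <= x <= x2 ->
    nm (V x y2 - Q (x +i* y2)%C - (V x y1 - Q (x +i* y1)%C)) <= M * (y2 - y1).
  move=> hx; apply: (vder_bound (g := fun y => V x y - Q (x +i* y)%C)
    (g' := fun y => 'i%C * f (x +i* y)%C - (a + l * (x +i* y)%C) * 'i%C)) => // y hy.
    by apply: (derB (hV (inD x y hx hy)) (der_comp (cy x y) (dQ _))).
  by rewrite [_ * 'i%C]mulrC -mulrBr Normc.normcM normc_i mul1r; apply: hM.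
have [l1 l2] : (y1 <= y1 <= y2) /\ (y1 <= y2 <= y2) by rewrite !lexx y12.
have [m1 m2] : (x1 <= x1 <= x2) /\ (x1 <= x2 <= x2) by rewrite !lexx x12.
have := hor _ l1; have := hor _ l2; have := ver _ m1; have := ver _ m2.
set h1 := (X in nm X <= _) => b1; set h2 := (X in nm X <= _) => b2.
set h3 := (X in nm X <= _) => b3; set h4 := (X in nm X <= _) => b4.
have -> : rint x1 x2 y1 y2 = (h4 + h1) - (h3 + h2).
  by rewrite /rint /h1 /h2 /h3 /h4; ring.
have := le_normcD (h4 + h1) (- (h3 + h2)); rewrite normcN.
have := le_normcD h4 h1; have := le_normcD h3 h2; lra.
Qed.

(** Near a point of differentiability the error of the affine approximation is o(size), and the
    boundary length gives a second factor of size. This quadratic smallness is what quadrisection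
    contradicts. *)
Lemma rint_local p q l : cder f (p +i* q)%C l -> forall e, 0 < e ->
  exists2 d, 0 < d & forall x1 x2 y1 y2, rect_in x1 x2 y1 y2 ->
    x1 <= p <= x2 -> y1 <= q <= y2 -> (x2 - x1) + (y2 - y1) < d ->
    nm (rint x1 x2 y1 y2) <= e * ((x2 - x1) + (y2 - y1)) ^+ 2.
Proof.
move=> hf e e0; have e2 : 0 < e / 2 by lra.
have [d d0 hd] := hf _ e2; exists d => // x1 x2 y1 y2 inD hp hq sd.
set s := x2 - x1 + (y2 - y1) in sd *; set P := (p +i* q)%C in hf hd *.
have x12 : x1 <= x2 by case/andP: hp => ? ?; lra.
have y12 : y1 <= y2 by case/andP: hq => ? ?; lra.
have -> : e * s ^+ 2 = 2 * (e / 2 * s) * s by field.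
apply: (rint_affine_bound (a := f P - l * P) (l := l)) => // x y hx hy.
have zs : nm ((x +i* y)%C - P) <= s.
  have -> : (x +i* y)%C - P = ((x - p) +i* (y - q))%C by [].
  rewrite (le_trans (normc_le_add _ _))// lerD//.
    by rewrite ler_norml; case/andP: hx; case/andP: hp => *; apply/andP; split; lra.
  by rewrite ler_norml; case/andP: hy; case/andP: hq => *; apply/andP; split; lra.
have := hd _ (le_lt_trans zs sd) => /= h.
rewrite (_ : _ - _ = f (x +i* y)%C - f P - l * ((x +i* y)%C - P)); last by ring.
by rewrite (le_trans h)// ler_wpM2l// ltW.
Qed.

Lemma rint_eq0_regular x1 x2 y1 y2 : x1 <= x2 -> y1 <= y2 -> rect_in x1 x2 y1 y2 ->
  (forall p q, x1 <= p <= x2 -> y1 <= q <= y2 -> exists l, cder f (p +i* q)%C l) ->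
  rint x1 x2 y1 y2 = 0.
Proof.
move=> x12 y12 inD hf; apply/eqP/negPn/negP => n0.
set N := nm (rint x1 x2 y1 y2); have N0 : 0 < N := normc_gt0 n0.
have [A [A0 eA]] : exists A, 0 <= A /\ x1 + A = x2.
  by exists (x2 - x1); split; lra.
have [B [B0 eB]] : exists B, 0 <= B /\ y1 + B = y2.
  by exists (y2 - y1); split; lra.
pose k n : R := 2^-1 ^+ n.
have kS n : k n = 2 * k n.+1 by rewrite /k exprS; field.
have k0 n : 0 <= k n by rewrite exprn_ge0// invr_ge0.
pose J n (u : R * R) := rint u.1 (u.1 + A * k n) u.2 (u.2 + B * k n).
(* The integral is the sum of those over four quarters, so one of them keeps at least a quarter of
   the modulus; after n steps N / 4^n remains. *)
pose big n u := N * (k n * k n) <= nm (J n u).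
(* The fourth quarter is the default: if the first three are not [big], the triangle inequality
   makes it so. *)
pose step n (u : R * R) :=
  let a := A * k n.+1 in let b := B * k n.+1 in
  if big n.+1 u then u
  else if big n.+1 (u.1 + a, u.2) then (u.1 + a, u.2)
  else if big n.+1 (u.1, u.2 + b) then (u.1, u.2 + b)
  else (u.1 + a, u.2 + b).
pose u := fix u n := if n is n'.+1 then step n' (u n') else (x1, y1).
have Ak n : 0 <= A * k n by rewrite mulr_ge0.
have Bk n : 0 <= B * k n by rewrite mulr_ge0.
have stepP n v : [/\ big n v -> big n.+1 (step n v),
    v.1 <= (step n v).1, v.2 <= (step n v).2,
    (step n v).1 + A * k n.+1 <= v.1 + A * k n &
    (step n v).2 + B * k n.+1 <= v.2 + B * k n].
  have ka : A * k n = 2 * (A * k n.+1) by rewrite [k n]kS; ring.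
  have kb : B * k n = 2 * (B * k n.+1) by rewrite [k n]kS; ring.
  have := Ak n.+1; have := Bk n.+1; rewrite /step; set a := A * k n.+1 in ka *.
  set b := B * k n.+1 in kb *; move=> a0 b0.
  case: ifP => [|/negbT h1]; first by split=> //; lra.
  case: ifP => [|/negbT h2]; first by split=> //=; lra.
  case: ifP => [|/negbT h3]; first by split=> //=; lra.
  split=> /=; try lra.
  move: h1 h2 h3; rewrite /big /J /= -!ltNge -/a -/b.
  have -> : v.1 + A * k n = v.1 + a + a by lra.
  have -> : v.2 + B * k n = v.2 + b + b by lra.
  have -> : N * (k n * k n) = 4 * (N * (k n.+1 * k n.+1)) by rewrite [k n]kS; ring.
  have -> : rint v.1 (v.1 + a + a) v.2 (v.2 + b + b) =
    rint v.1 (v.1 + a) v.2 (v.2 + b) + rint (v.1 + a) (v.1 + a + a) v.2 (v.2 + b) +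
    (rint v.1 (v.1 + a) (v.2 + b) (v.2 + b + b) +
     rint (v.1 + a) (v.1 + a + a) (v.2 + b) (v.2 + b + b)) by rewrite /rint; ring.
  set j1 := rint v.1 (v.1 + a) v.2 (v.2 + b); set j2 := rint _ _ v.2 (v.2 + b).
  set j3 := rint v.1 _ _ _; set j4 := rint _ _ _ _ => h1 h2 h3 h4.
  have := le_normcD (j1 + j2) (j3 + j4); have := le_normcD j1 j2.
  by have := le_normcD j3 j4; lra.
have bigu n : big n (u n).
  elim: n => [|n IH]; last by have [+ _ _ _ _] := stepP n (u n); apply.
  by rewrite /big /J /k expr0 !mulr1 /= eA eB; exact: lexx.
have [p hp] := @nested_point _ (fun n => (u n).1) (fun n => A * k n)
  (fun n => let: And5 _ h _ _ _ := stepP n (u n) in h)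
  (fun n => let: And5 _ _ _ h _ := stepP n (u n) in h) Ak.
have [q hq] := @nested_point _ (fun n => (u n).2) (fun n => B * k n)
  (fun n => let: And5 _ _ h _ _ := stepP n (u n) in h)
  (fun n => let: And5 _ _ _ _ h := stepP n (u n) in h) Bk.
have sub n : [/\ x1 <= (u n).1, y1 <= (u n).2, (u n).1 + A * k n <= x2 &
    (u n).2 + B * k n <= y2].
  elim: n => [|n [i1 i2 i3 i4]]; last first.
    have [_ j1 j2 j3 j4] := stepP n (u n).
    by split; [apply: le_trans j1|apply: le_trans j2|apply: le_trans i3
              |apply: le_trans i4].
  by rewrite /k expr0 !mulr1 /=; split=> //; lra.
have [l hl] : exists l, cder f (p +i* q)%C l.
  have := hp 0%N; have := hq 0%N; rewrite /k expr0 !mulr1 /=.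
  by move=> /andP[? ?] /andP[? ?]; apply: hf; apply/andP; split; lra.
set S := A + B; have S1 : 0 < S ^+ 2 + 1 by have := sqr_ge0 S; lra.
(* With this e, e (S k_n)^2 < N k_n^2, against [bigu n]; the summand 1 covers S = 0. *)
have e0 : 0 < N / (2 * (S ^+ 2 + 1)) by apply: divr_gt0 => //; lra.
have [d d0 hd] := rint_local hl e0.
have [n hn] := halving_small S d0; rewrite -/(k n) in hn.
have [s1 s2 s3 s4] := sub n.
have kp : 0 < k n by rewrite exprn_gt0// invr_gt0.
have E : (u n).1 + A * k n - (u n).1 + ((u n).2 + B * k n - (u n).2) = S * k n.
  by rewrite /S; ring.
have inDn : rect_in (u n).1 ((u n).1 + A * k n) (u n).2 ((u n).2 + B * k n).
  move=> x y /andP[h1 h2] /andP[h3 h4]; apply: inD.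
    by rewrite (le_trans s1 h1) (le_trans h2 s3).
  by rewrite (le_trans s2 h3) (le_trans h4 s4).
have := hd _ _ _ _ inDn (hp n) (hq n); rewrite E => /(_ hn).
apply/negP; rewrite -ltNge; apply: lt_le_trans (bigu n).
rewrite exprMn [k n ^+ 2]expr2 mulrA ltr_pM2r ?mulr_gt0//.
rewrite mulrAC ltr_pdivrMr; last lra.
by rewrite ltr_pM2l//; have := sqr_ge0 S; lra.
Qed.

Lemma rint_degx x y1 y2 : rint x x y1 y2 = 0.
Proof. by rewrite /rint; ring. Qed.

Lemma rint_degy y x1 x2 : rint x1 x2 y y = 0.
Proof. by rewrite /rint; ring. Qed.

(** A small square around c, clipped to the rectangle, is cut out. The four remaining strips are
    degenerate or avoid c, so they contribute 0; in the square f is bounded and the boundary is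
    arbitrarily short. *)
Lemma rint_eq0 (c : C) x1 x2 y1 y2 :
  x1 <= x2 -> y1 <= y2 -> rect_in x1 x2 y1 y2 ->
  (forall p q, x1 <= p <= x2 -> y1 <= q <= y2 -> (p +i* q)%C != c ->
     exists l, cder f (p +i* q)%C l) ->
  vanishing id c (fun z => f z - f c) ->
  rint x1 x2 y1 y2 = 0.
Proof.
move=> x12 y12 inD hf fc.
have reg X1 X2 Y1 Y2 : x1 <= X1 -> X1 <= X2 -> X2 <= x2 ->
    y1 <= Y1 -> Y1 <= Y2 -> Y2 <= y2 ->
    [|| complex.Re c < X1, X2 < complex.Re c, complex.Im c < Y1 | Y2 < complex.Im c] ->
    rint X1 X2 Y1 Y2 = 0.
  move=> h1 h2 h3 h4 h5 h6 nc; apply: rint_eq0_regular => // [p q|p q] /andP[p1 p2] /andP[q1 q2].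
    by apply: inD; apply/andP; split; lra.
  apply: hf; try by apply/andP; split; lra.
  apply: contraTneq nc => <- /=; rewrite !negb_or -!leNgt.
  by rewrite p1 p2 q1 q2.
have [|] := boolP [|| complex.Re c < x1, x2 < complex.Re c, complex.Im c < y1 | y2 < complex.Im c].
  exact: reg.
rewrite !negb_or -!leNgt => /and4P[cx1 cx2 cy1 cy2].
set cx := complex.Re c in reg cx1 cx2; set cy := complex.Im c in reg cy1 cy2.
have [d d0 hd] := fc _ ltr01.
set M := nm (f c) + 1; have M0 : 0 < M by have := normc_ge0 (f c); rewrite /M; lra.
apply: normc_eq0P => e e0.
(* The bound d / 4 keeps the square, whose points are within 2 s of c, in the disc where |f| <= M.
   Its sides add up to at most 4 s, and 2 M (4 s) <= e. *)
pose s := Num.min (d / 4) (e / (8 * M)).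
have s0 : 0 < s by rewrite lt_min !divr_gt0//; lra.
have sd : s <= d / 4 by rewrite ge_min lexx.
have se : s * (8 * M) <= e by rewrite -ler_pdivlMr ?ge_min ?lexx ?orbT//; lra.
pose X1 := Num.max x1 (cx - s); pose X2 := Num.min x2 (cx + s).
pose Y1 := Num.max y1 (cy - s); pose Y2 := Num.min y2 (cy + s).
have hX1 : [/\ x1 <= X1, cx - s <= X1 & X1 <= cx].
  by rewrite /X1 !le_max ge_max !lexx orbT; split=> //; apply/andP; split=> //; lra.
have hX2 : [/\ X2 <= x2, X2 <= cx + s & cx <= X2].
  by rewrite /X2 !ge_min le_min !lexx orbT; split=> //; apply/andP; split=> //; lra.
have hY1 : [/\ y1 <= Y1, cy - s <= Y1 & Y1 <= cy].
  by rewrite /Y1 !le_max ge_max !lexx orbT; split=> //; apply/andP; split=> //; lra.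
have hY2 : [/\ Y2 <= y2, Y2 <= cy + s & cy <= Y2].
  by rewrite /Y2 !ge_min le_min !lexx orbT; split=> //; apply/andP; split=> //; lra.
case: hX1 hX2 hY1 hY2 => a1 a2 a3 [b1 b2 b3] [c1 c2 c3] [e1 e2 e3].
have z1 : rint x1 X1 y1 y2 = 0.
  rewrite /X1 in a1 a2 a3 *; case: (leP x1 (cx - s)) a1 a2 a3 => h *; last exact: rint_degx.
  by apply: reg => //; try lra; apply/or4P; apply: Or42; lra.
have z2 : rint X2 x2 y1 y2 = 0.
  rewrite /X2 in b1 b2 b3 *; case: (leP x2 (cx + s)) b1 b2 b3 => h *; first exact: rint_degx.
  by apply: reg => //; try lra; apply/or4P; apply: Or41; lra.
have z3 : rint X1 X2 y1 Y1 = 0.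
  rewrite /Y1 in c1 c2 c3 *; case: (leP y1 (cy - s)) c1 c2 c3 => h *; last exact: rint_degy.
  by apply: reg => //; try lra; apply/or4P; apply: Or44; lra.
have z4 : rint X1 X2 Y2 y2 = 0.
  rewrite /Y2 in e1 e2 e3 *; case: (leP y2 (cy + s)) e1 e2 e3 => h *; first exact: rint_degy.
  by apply: reg => //; try lra; apply/or4P; apply: Or43; lra.
rewrite (rint_splitx X1) z1 add0r (rint_splitx X2) z2 addr0.
rewrite (rint_splity Y1) z3 add0r (rint_splity Y2) z4 addr0.
have /= := @rint_affine_bound 0 0 X1 X2 Y1 Y2 M => h.
apply: (le_trans (h _ _ _ _)); try lra.
- by move=> x y /andP[? ?] /andP[? ?]; apply: inD; apply/andP; split; lra.
- move=> x y /andP[? ?] /andP[? ?]; rewrite mul0r addr0 subr0.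
  have : nm ((x +i* y)%C - c) < d.
    have -> : (x +i* y)%C - c = ((x - cx) +i* (y - cy))%C by rewrite /cx /cy; case: (c).
    apply: (le_lt_trans (normc_le_add _ _)).
    have : `|x - cx| <= s by rewrite ler_norml; apply/andP; split; lra.
    have : `|y - cy| <= s by rewrite ler_norml; apply/andP; split; lra.
    by lra.
  by move=> /hd; have := le_normc_sub (f (x +i* y)%C) (f c); rewrite /M; lra.
apply: le_trans se; have W4 : X2 - X1 + (Y2 - Y1) <= 4 * s by lra.
by have := ler_wpM2l (ltW M0) W4; lra.
Qed.

Lemma sqr_le_max (x1 x2 p : R) : x1 <= p <= x2 -> p ^+ 2 <= x1 ^+ 2 \/ p ^+ 2 <= x2 ^+ 2.
Proof.
move=> /andP[h1 h2]; case: (lerP 0 p) => h; first by right; nra.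
by left; nra.
Qed.

(** On an interval a square is largest at an endpoint, so the point farthest from the origin is a
    corner. *)
Lemma rect_in_corners x1 x2 y1 y2 :
  x1 ^+ 2 + y1 ^+ 2 < r ^+ 2 -> x1 ^+ 2 + y2 ^+ 2 < r ^+ 2 ->
  x2 ^+ 2 + y1 ^+ 2 < r ^+ 2 -> x2 ^+ 2 + y2 ^+ 2 < r ^+ 2 -> rect_in x1 x2 y1 y2.
Proof.
move=> ? ? ? ? x y /sqr_le_max hx /sqr_le_max hy.
by case: hx => ?; case: hy => ?; lra.
Qed.

(** The endpoints may come in either order, since exchanging two of them only changes the sign of
    [rint]. *)
Lemma rint_eq0_corners (c : C) x1 x2 y1 y2 :
  (forall z, nm z < r -> z != c -> exists l, cder f z l) ->
  vanishing id c (fun z => f z - f c) -> 0 <= r ->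
  x1 ^+ 2 + y1 ^+ 2 < r ^+ 2 -> x1 ^+ 2 + y2 ^+ 2 < r ^+ 2 ->
  x2 ^+ 2 + y1 ^+ 2 < r ^+ 2 -> x2 ^+ 2 + y2 ^+ 2 < r ^+ 2 ->
  rint x1 x2 y1 y2 = 0.
Proof.
move=> hf fc r0.
wlog x12 : x1 x2 / x1 <= x2.
  move=> W h1 h2 h3 h4; case: (leP x1 x2) => h; first exact: W.
  have -> : rint x1 x2 y1 y2 = - rint x2 x1 y1 y2 by rewrite /rint; ring.
  by rewrite W ?oppr0// ltW.
wlog y12 : y1 y2 / y1 <= y2.
  move=> W h1 h2 h3 h4; case: (leP y1 y2) => h; first exact: W.
  have -> : rint x1 x2 y1 y2 = - rint x1 x2 y2 y1 by rewrite /rint; ring.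
  by rewrite W ?oppr0// ltW.
move=> h1 h2 h3 h4; have inD := rect_in_corners h1 h2 h3 h4.
apply: (rint_eq0 (c := c)) => // p q hp hq; apply: hf.
by rewrite normc_ltE//; apply: inD.
Qed.

End Goursat.

(** * Primitives on a disc *)

Section DiscPrimitive.
Variable R : realType.
Local Notation C := R[i].

Lemma vanishing_comp T (i : T -> C) (g : T -> C) (f : C -> C) z :
  vanishing i z (fun w => g w - g z) -> vanishing id (g z) (fun w => f w - f (g z)) ->
  vanishing i z (fun w => f (g w) - f (g z)).
Proof.
move=> hg hf e /hf[d d0 hd]; have d2 : 0 < d / 2 by lra.
have [d' d'0 hd'] := hg _ d2; exists d' => // w /hd' hw.
by apply: hd; apply: (le_lt_trans hw); lra.
Qed.

(** The loss from rho to r makes the closed chords of the disc of radius r lie where f is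
    continuous, so that f has primitives along their interiors. *)
Lemma disc_primitive (f : C -> C) (c : C) (r rho : R) : 0 < r -> r < rho ->
  (forall z, nm z < rho -> z != c -> exists l, cder f z l) ->
  vanishing id c (fun w => f w - f c) ->
  exists K, forall z, nm z < r -> cder K z (f z).
Proof.
move=> r0 rrho hf fc.
have cf z : nm z < rho -> vanishing id z (fun w => f w - f z).
  move=> hz; have [->//|zc] := eqVneq z c.
  by have [l hl] := hf _ hz zc; apply: der_vanishing hl.
have inrho x y : x ^+ 2 + y ^+ 2 <= r ^+ 2 -> nm (x +i* y)%C < rho.
  move=> h; rewrite normc_ltE; last lra.
  by apply: le_lt_trans h _; rewrite ltr_sqr// nnegrE; lra.
have bnd (x y : R) : - Num.sqrt (r ^+ 2 - y ^+ 2) <= x <= Num.sqrt (r ^+ 2 - y ^+ 2) ->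
    y ^+ 2 < r ^+ 2 -> x ^+ 2 + y ^+ 2 <= r ^+ 2.
  rewrite -ler_norml => h1 h2; rewrite -lerBrDr.
  rewrite -[leLHS]real_normK ?num_real// -[leRHS]sqr_sqrtr; last lra.
  by rewrite ler_sqr// nnegrE.
have bnd' (x y : R) : x ^+ 2 + y ^+ 2 < r ^+ 2 ->
    - Num.sqrt (r ^+ 2 - y ^+ 2) < x < Num.sqrt (r ^+ 2 - y ^+ 2).
  move=> h; rewrite -ltr_norml -ltr_sqr ?nnegrE// sqr_sqrtr ?real_normK ?num_real//; last first.
    by have := sqr_ge0 x; lra.
  by lra.
have cx (x y : R) : vder (fun s => (s +i* y)%C) x 1.
  exact: (is_derive_vder (is_derive_id x 1) (is_derive_cst y x 1)).
have cy (x y : R) : vder (fun s => (x +i* s)%C) y 'i%C.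
  exact: (is_derive_vder (is_derive_cst x y 1) (is_derive_id y 1)).
have [H hH] : {H : R -> R -> C & forall y x, x ^+ 2 + y ^+ 2 < r ^+ 2 ->
    vder (H y) x (f (x +i* y)%C)}.
  apply: (@choice R (R -> C) (fun y G => forall x, x ^+ 2 + y ^+ 2 < r ^+ 2 ->
    vder G x (f (x +i* y)%C))) => y.
  have [hy|hy] := ltP (y ^+ 2) (r ^+ 2); last first.
    (* This line misses the open disc, so any function will do. *)
    by exists (fun=> 0) => x; have := sqr_ge0 x; lra.
  have [|G hG] := @vder_primitive _ (fun x => f (x +i* y)%C) (Num.sqrt (r ^+ 2 - y ^+ 2)).
    move=> x /bnd/(_ hy)/inrho/cf.
    by apply: (vanishing_comp (g := fun x => (x +i* y)%C)) (der_vanishing (cx x y)).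
  by exists G => x /bnd' hx; apply: hG.
have [V hV] : {V : R -> R -> C & forall x y, x ^+ 2 + y ^+ 2 < r ^+ 2 ->
    vder (V x) y ('i%C * f (x +i* y)%C)}.
  apply: (@choice R (R -> C) (fun x G => forall y, x ^+ 2 + y ^+ 2 < r ^+ 2 ->
    vder G y ('i%C * f (x +i* y)%C))) => x.
  have [hx|hx] := ltP (x ^+ 2) (r ^+ 2); last first.
    by exists (fun=> 0) => y; have := sqr_ge0 y; lra.
  have [|G hG] := @vder_primitive _ (fun y => f (x +i* y)%C) (Num.sqrt (r ^+ 2 - x ^+ 2)).
    move=> y /bnd/(_ hx); rewrite addrC => /inrho/cf.
    by apply: (vanishing_comp (g := fun y => (x +i* y)%C)) (der_vanishing (cy x y)).
  exists (fun y => 'i%C * G y) => y; rewrite addrC => /bnd' hy.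
  by apply: derZ; apply: hG.
have sq (x y : R) : nm (x +i* y)%C < r -> x ^+ 2 + y ^+ 2 < r ^+ 2.
  by rewrite normc_ltE// ltW.
(* Integration along the real axis up to Re z and then vertically up to z. *)
pose P (z : C) := H 0 (complex.Re z) + (V (complex.Re z) (complex.Im z) - V (complex.Re z) 0).
exists P => -[x y] hz e e0.
have e2 : 0 < e / 2 by lra.
have [d d0 hd] := cf _ (lt_trans hz rrho) _ e2.
exists (Num.min d (r - nm (x +i* y)%C)) => [|[x' y']]; first by rewrite lt_min d0 subr_gt0.
have -> : id (x' +i* y')%C - id (x +i* y)%C = ((x' - x) +i* (y' - y))%C by [].
set w := (_ +i* _)%C; rewrite lt_min => /andP[wd wr].
have wx : `|x' - x| <= nm w := ge_Re_normc w.
have wy : `|y' - y| <= nm w := ge_Im_normc w.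
have near (s t : R) : `|s - x| <= `|x' - x| -> `|t - y| <= `|y' - y| ->
    nm ((s +i* t) - (x +i* y))%C <= nm w.
  move=> h1 h2; rewrite -ler_sqr ?nnegrE ?normc_ge0//.
  have -> : ((s +i* t) - (x +i* y) = (s - x) +i* (t - y))%C by [].
  by rewrite !normc_sqr lerD// -ler_sqrt ?sqr_ge0// !sqrtr_sqr.
have inr (s t : R) : `|s - x| <= `|x' - x| -> `|t - y| <= `|y' - y| -> s ^+ 2 + t ^+ 2 < r ^+ 2.
  move=> h1 h2; apply: sq.
  have := near _ _ h1 h2; have := le_normc_sub (s +i* t)%C (x +i* y)%C; lra.
have btw (a b s : R) : Num.min a b <= s <= Num.max a b -> `|s - a| <= `|b - a|.
  case: (leP a b) => ab /andP[h1 h2].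
    by rewrite !ger0_norm; lra.
  by rewrite !ler0_norm; lra.
(* This rectangle reroutes the path to x' + i y' through x + i y, so the increment of P becomes a
   horizontal piece at height y plus a vertical piece at abscissa x'. On each piece f is within e /
   2 of its value at x + i y. *)
have eq0 : rint H V x x' 0 y = 0.
  apply: (@rint_eq0_corners R f r H V (fun x y => hH y x) hV c) => //; rewrite ?(ltW r0)//.
  - by move=> z zr; apply: hf; apply: lt_trans rrho.
  - by have := inr x y; rewrite !subrr normr0 !normr_ge0 => /(_ isT isT); have := sqr_ge0 y; rewrite expr0n addr0; lra.
  - by apply: inr; rewrite ?subrr ?normr0 ?normr_ge0.
  - by have := inr x' y; rewrite !subrr normr0 !normr_ge0 lexx => /(_ isT isT); have := sqr_ge0 y; rewrite expr0n addr0; lra.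
  - by apply: inr; rewrite ?subrr ?normr0 ?normr_ge0.
have b1 : nm (H y x' - f (x +i* y)%C * x'%:C%C - (H y x - f (x +i* y)%C * x%:C%C)) <= e / 2 * `|x' - x|.
  apply: (vder_bound_sym (g := fun s => H y s - f (x +i* y)%C * s%:C%C)
    (g' := fun s => f (s +i* y)%C - f (x +i* y)%C * 1)) => s /btw hs.
    apply: (derB (hH _ _ _) (derZ _ (der_id _ _))).
    by apply: inr => //; rewrite subrr normr0.
  rewrite mulr1; apply: hd; apply: le_lt_trans wd; apply: near => //.
  by rewrite subrr normr0.
have b2 : nm (V x' y' - 'i%C * f (x +i* y)%C * y'%:C%C - (V x' y - 'i%C * f (x +i* y)%C * y%:C%C)) <= e / 2 * `|y' - y|.
  apply: (vder_bound_sym (g := fun s => V x' s - 'i%C * f (x +i* y)%C * s%:C%C)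
    (g' := fun s => 'i%C * f (x' +i* s)%C - 'i%C * f (x +i* y)%C * 1)) => s /btw hs.
    apply: (derB (hV _ _ _) (derZ _ (der_id _ _))).
    by apply: inr.
  rewrite mulr1 -mulrBr Normc.normcM normc_i mul1r.
  by apply: hd; apply: le_lt_trans wd; apply: near.
move: b1 b2; set u1 := (X in nm X <= _) => b1; set u2 := (X in nm X <= _) => b2.
have -> : P (x' +i* y')%C - P (x +i* y)%C - f (x +i* y)%C * w = u1 + u2.
  have -> : w = (x'%:C%C - x%:C%C) + 'i%C * (y'%:C%C - y%:C%C).
    by rewrite /w [LHS]complexE /= !rmorphB.
  apply/eqP; rewrite -subr_eq0 -[X in _ == X]eq0; apply/eqP.
  by rewrite /P /u1 /u2 /rint /=; ring.
apply: (le_trans (le_normcD _ _)).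
by have := ler_pM (ltW e2) (normr_ge0 _) (lexx _) wx; have := ler_pM (ltW e2) (normr_ge0 _) (lexx _) wy; lra.
Qed.

End DiscPrimitive.

(** * Circle means and the Cauchy formula *)

Section Mean.
Variable R : realType.
Local Notation C := R[i].

Lemma conjcB (z w : C) : conjc (z - w) = conjc z - conjc w.
Proof. exact: rmorphB. Qed.

Lemma conjcM (z w : C) : conjc (z * w) = conjc z * conjc w.
Proof. exact: rmorphM. Qed.

Lemma normc_conj (z : C) : nm (conjc z) = nm z.
Proof. by apply: complexI; rewrite -!norm_normc normcJ. Qed.

Definition cis (t : R) : C := (cos t +i* sin t)%C.

(** The value is normalised by 2 pi, so a constant is its own mean and the Cauchy formula carries no
    factor. *)
Definition is_mean (phi : R -> C) (v : C) := exists2 Phi : R -> C,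
  (forall t, 0 <= t <= 2 * pi -> vder Phi t (phi t)) &
  Phi (2 * pi) - Phi 0 = (2 * pi)%:C%C * v.

Lemma normc_cis t : nm (cis t) = 1.
Proof. by rewrite /cis /= cos2Dsin2 sqrtr1. Qed.

Lemma cis_neq0 t : cis t != 0.
Proof.
by apply/eqP => h; have := normc_cis t; rewrite h Normc.normc0 => /esym/eqP; rewrite oner_eq0.
Qed.

Lemma cis0 : cis 0 = 1.
Proof. by rewrite /cis cos0 sin0. Qed.

Lemma cis2pi : cis (2 * pi) = 1.
Proof. by rewrite /cis mulrC mulr_natr cos2pi sin2pi. Qed.

Lemma conj_cis t : (cis t)^*%C = (cis t)^-1.
Proof.
apply: (mulfI (cis_neq0 t)); rewrite mulfV ?cis_neq0//.
by rewrite -sqr_normc norm_normc normc_cis expr1n.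
Qed.

Lemma vder_cis t : vder cis t ('i%C * cis t).
Proof.
have -> : 'i%C * cis t = (- sin t +i* cos t)%C.
  by rewrite /cis /GRing.mul /=; congr (_ +i* _)%C; ring.
exact: is_derive_vder (is_derive_cos t) (is_derive_sin t).
Qed.

Lemma two_pi_gt0 : 0 < 2 * pi :> R.
Proof. by have := pi_gt0 R; lra. Qed.

Lemma eq_mean phi psi v w : is_mean phi v -> phi =1 psi -> v = w -> is_mean psi w.
Proof. by move=> h /funext <- <-. Qed.

Lemma meanD phi psi v w :
  is_mean phi v -> is_mean psi w -> is_mean (fun t => phi t + psi t) (v + w).
Proof.
move=> [F dF eF] [G dG eG]; exists (fun t => F t + G t) => [t ht|].
  exact: derD (dF _ ht) (dG _ ht).
by rewrite [RHS]mulrDr -eF -eG; ring.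
Qed.

Lemma meanZ c phi v : is_mean phi v -> is_mean (fun t => c * phi t) (c * v).
Proof.
move=> [F dF eF]; exists (fun t => c * F t) => [t ht|].
  exact: derZ (dF _ ht).
by rewrite [RHS]mulrCA -eF; ring.
Qed.

Lemma mean_cst c : is_mean (fun=> c) c.
Proof.
exists (fun t => c * t%:C%C) => [t ht|]; last by rewrite mulr0 subr0 mulrC.
by have := derZ c (der_id (real_complex R) t); rewrite mulr1.
Qed.

Lemma mean_conj phi v : is_mean phi v -> is_mean (fun t => (phi t)^*%C) v^*%C.
Proof.
move=> [F dF eF]; exists (fun t => (F t)^*%C) => [t ht e e0|].
  have [d d0 hd] := dF t ht e e0; exists d => // s /hd.
  set A := (X in nm X <= _) => hA; set B := (X in nm X <= _).
  suff -> : B = A^*%C.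
    by rewrite normc_conj.
  by rewrite /A /B !conjcB conjcM conjcB !conjc_real.
by rewrite -conjcB eF conjcM conjc_real.
Qed.

Lemma mean_bound phi v M :
  is_mean phi v -> (forall t, nm (phi t) <= M) -> nm v <= M.
Proof.
move=> [F dF eF] hM; have p0 := two_pi_gt0.
have := vder_bound (ltW p0) dF (fun t _ => hM t).
rewrite eF Normc.normcM normc_real gtr0_norm// subr0 [M * _]mulrC.
by rewrite ler_pM2l.
Qed.

Lemma mean_exists phi : (forall t, exists l, vder phi t l) -> exists v, is_mean phi v.
Proof.
move=> h; have p0 := two_pi_gt0.
(* The extra 1 puts the closed interval from 0 to 2 pi inside the open interval where F is a
   primitive. *)
have [|F hF] := @vder_primitive _ phi (2 * pi + 1).
  by move=> t _; have [l hl] := h t; apply: der_vanishing hl.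
have p0' : (2 * pi)%:C%C != 0 :> C by apply: contraTneq p0 => /complexI ->; rewrite ltxx.
exists ((F (2 * pi) - F 0) / (2 * pi)%:C%C); exists F; last first.
  by rewrite [RHS]mulrC divfK.
by move=> t /andP[t1 t2]; apply: hF; apply/andP; split; lra.
Qed.

Lemma vder_circle r t : vder (fun s => r%:C%C * cis s) t (r%:C%C * ('i%C * cis t)).
Proof. exact: derZ (vder_cis t). Qed.

Lemma normc_circle r t : 0 < r -> nm (r%:C%C * cis t) = r.
Proof. by move=> r0; rewrite Normc.normcM normc_real normc_cis mulr1 gtr0_norm. Qed.

Lemma real_neq0 (r : R) : 0 < r -> r%:C%C != 0 :> C.
Proof. by move=> r0; apply: contraTneq r0 => /complexI ->; rewrite ltxx. Qed.

Lemma i_neq0 : 'i%C != 0 :> C.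
Proof. by apply/eqP => h; have := normc_i R; rewrite h Normc.normc0; lra. Qed.

(** Since dz = i r e^(it) dt, this mean is a multiple of the integral of k over the circle, which
    vanishes because k has a primitive on a slightly larger disc. *)
Lemma mean_closed (k : C -> C) (c : C) (r rho : R) : 0 < r -> r < rho ->
  (forall z, nm z < rho -> z != c -> exists l, cder k z l) ->
  vanishing id c (fun w => k w - k c) ->
  is_mean (fun t => cis t * k (r%:C%C * cis t)) 0.
Proof.
move=> r0 rr hk kc.
have [||K hK] := @disc_primitive _ k c ((r + rho) / 2) rho _ _ hk kc; try lra.
have i0 := i_neq0; have rn := real_neq0 r0.
exists (fun t => ('i%C * r%:C%C)^-1 * K (r%:C%C * cis t)) => [t _|]; last first.
  by rewrite cis2pi cis0 subrr mulr0.
have hz : nm (r%:C%C * cis t) < (r + rho) / 2 by rewrite normc_circle//; lra.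
apply: der_congr (derZ _ (der_comp (vder_circle r t) (hK _ hz))) _ _ => //.
by field; rewrite i0 rn.
Qed.

Lemma cder_inv (u : C) : u != 0 -> cder (fun z => z^-1) u (- (u ^+ 2)^-1).
Proof.
move=> u0; apply/cderP.
have di := @derivable_id _ C u 1.
apply: DeriveDef; first exact: (@derivableV _ _ id u 1 u0 di).
by rewrite (@deriveV _ _ id u 1 u0 di) derive_id /GRing.scale /= mulr1.
Qed.

(** On the circle the kernel is the conjugate of 1 / (1 - b e^(it)) with b = conj(a) / r. This
    equals 1 + b e^(it) / (1 - b e^(it)), whose second term has mean 0 by [mean_closed]; no contour
    is deformed. The bound |a| <= r / 2 pushes the pole 1 / b out of the disc of radius 2. *)
Lemma mean_cauchy_kernel (a : C) r : 0 < r -> nm a <= r / 2 ->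
  is_mean (fun t => r%:C%C * cis t / (r%:C%C * cis t - a)) 1.
Proof.
move=> r0 ar; have rn := real_neq0 r0.
pose b := a^*%C / r%:C%C.
have nb : nm b <= 2^-1.
  rewrite Normc.normcM Normc.normcV normc_real gtr0_norm//.
  rewrite normc_conj.
  by rewrite ler_pdivrMr//; lra.
have den z : nm z < 2 -> 1 - b * z != 0.
  move=> hz; apply/eqP => h.
  have : nm (b * z) < 1.
    by rewrite Normc.normcM; have := normc_ge0 b; have := normc_ge0 z; nra.
  have <- : 1 = b * z by apply/eqP; rewrite -subr_eq0 h.
  by rewrite Normc.normc1 ltxx.
have dk z : nm z < 2 -> cder (fun u => (1 - b * u)^-1) z (- ((1 - b * z) ^+ 2)^-1 * (0 - b * 1)).
  move=> hz; apply: (der_comp (f := fun u => 1 - b * u)).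
    exact: derB (der_cst _ _ _) (derZ b (der_id id z)).
  exact: cder_inv (den _ hz).
have m0 := @mean_closed (fun u => (1 - b * u)^-1) 0 1 2.
have {}m0 : is_mean (fun t => cis t * (1 - b * cis t)^-1) 0.
  apply: eq_mean (m0 _ _ _ _) _ _ => //; try lra.
  - by move=> z hz _; eexists; apply: dk hz.
  - by apply: der_vanishing (dk 0 _); rewrite Normc.normc0; lra.
  - by move=> t; rewrite mul1r.
have m1 := mean_conj (meanD (mean_cst 1) (meanZ b m0)).
apply: eq_mean m1 _ _ => [t|]; last by rewrite mulr0 addr0 conjc1.
have d1 : 1 - b * cis t != 0 by apply: den; rewrite normc_cis; lra.
have -> : 1 + b * (cis t * (1 - b * cis t)^-1) = (1 - b * cis t)^-1 by field.
rewrite conjc_inv conjcB conjc1 !conjcM conjcK conjc_inv conjc_real conj_cis.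
have c0 := cis_neq0 t.
have d2 : r%:C%C * cis t - a != 0.
  apply/eqP => h; have := normc_circle t r0.
  have -> : r%:C%C * cis t = a by apply/eqP; rewrite -subr_eq0 h.
  by lra.
have d3 : 1 - a / r%:C%C * (cis t)^-1 != 0.
  have -> : 1 - a / r%:C%C * (cis t)^-1 = (r%:C%C * cis t - a) / (r%:C%C * cis t).
    by field; rewrite c0 rn.
  by rewrite mulf_neq0// invr_neq0// mulf_neq0.
by field; rewrite c0 rn d2.
Qed.

(** On the circle f(z) z / (z - a) = z q(z) + f(a) z / (z - a), where q is the difference quotient
    of f at a. The first term has mean 0 and the second has mean f(a). *)
Lemma cauchy_formula (f : C -> C) (a : C) (r rho : R) : 0 < r -> r < rho ->
  (forall z, nm z < rho -> exists l, cder f z l) -> nm a <= r / 2 ->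
  is_mean (fun t => f (r%:C%C * cis t) * (r%:C%C * cis t / (r%:C%C * cis t - a))) (f a).
Proof.
move=> r0 rr hf ar.
have [l hl] : exists l, cder f a l by apply: hf; lra.
pose q w := if w == a then l else (f w - f a) / (w - a).
have qc : vanishing id a (fun w => q w - q a).
  move=> e e0; have [d d0 hd] := hl _ e0; exists d => // w /hd h; rewrite /q eqxx.
  case: eqVneq => [_|wa]; first by rewrite subrr Normc.normc0 ltW.
  have wa0 : w - a != 0 by rewrite subr_eq0.
  have -> : (f w - f a) / (w - a) - l = (f w - f a - l * (w - a)) / (w - a) by field.
  by rewrite Normc.normcM Normc.normcV ler_pdivrMr ?normc_gt0.
have qd z : nm z < rho -> z != a -> exists l, cder q z l.
  move=> /hf[m hm] za; have za0 : z - a != 0 by rewrite subr_eq0.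
  have dn : cder (fun w => f w - f a) z (m - 0) by apply: derB hm (der_cst _ _ _).
  have dd : cder (fun w => w - a) z (1 - 0) by apply: derB (der_id _ _) (der_cst _ _ _).
  eexists; apply: eq_der (derM dn (der_comp dd (cder_inv za0))).
  exists (nm (z - a)) => [|w hw]; first exact: normc_gt0.
  rewrite /q; case: eqVneq => // wa.
  by move: hw; rewrite wa normcB ltxx.
have m1 := meanD (meanZ r%:C%C (mean_closed r0 rr qd qc)) (meanZ (f a) (mean_cauchy_kernel r0 ar)).
apply: eq_mean m1 _ _ => [t|]; last by rewrite mulr0 add0r mulr1.
have d2 : r%:C%C * cis t - a != 0.
  apply/eqP => h; have := normc_circle t r0.
  have -> : r%:C%C * cis t = a by apply/eqP; rewrite -subr_eq0 h.
  by lra.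
have za : r%:C%C * cis t == a = false by rewrite -subr_eq0 (negbTE d2).
by rewrite /q za; field.
Qed.

Lemma quadratic_der (f : C -> C) a l K d : 0 < d ->
  (forall w, nm (w - a) < d -> nm (f w - f a - l * (w - a)) <= K * nm (w - a) ^+ 2) ->
  cder f a l.
Proof.
move=> d0 h e e0; have K0 : 0 < `|K| + 1 by have := normr_ge0 K; lra.
exists (Num.min d (e / (`|K| + 1))) => [|w]; first by rewrite lt_min d0 divr_gt0.
rewrite lt_min => /andP[/h hw]; rewrite ltr_pdivlMr// => he.
apply: (le_trans hw); rewrite expr2 mulrA ler_wpM2r ?normc_ge0//.
by have := ler_norm K; have := normc_ge0 (w - a); rewrite /= in he *; nra.
Qed.

(** Differentiating the Cauchy kernel in a gives the candidates S for f' and 2 T for f''. Explicit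
    quadratic remainders replace differentiation under the integral sign. *)
Lemma derivative_differentiable (f : C -> C) (rho : R) : 0 < rho ->
  (forall z, nm z < rho -> exists l, cder f z l) ->
  exists2 d, 0 < d & forall z, nm z < d -> exists l, cder (derive1 f) z l.
Proof.
move=> rho0 hf.
have [l0 hl0] : exists l, cder f 0 l by apply: hf; rewrite Normc.normc0.
have [d d0 hd] := der_vanishing hl0 ltr01.
(* Taking r < d bounds f on the circle by continuity at 0 alone, without compactness. *)
have [r [r0 rrho rd]] : exists r, [/\ 0 < r, r < rho & r < d].
  have mr : 0 < Num.min d rho by rewrite lt_min d0.
  have mrho : Num.min d rho <= rho by rewrite ge_min lexx orbT.
  have md : Num.min d rho <= d by rewrite ge_min lexx.
  by exists (Num.min d rho / 2); split; lra.
pose M := nm (f 0) + 1; have M0 : 0 < M by have := normc_ge0 (f 0); rewrite /M; lra.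
have [z zE] : exists z, z = (fun t => r%:C%C * cis t) by eexists.
have nz t : nm (z t) = r by rewrite zE normc_circle.
have fM t : nm (f (z t)) <= M.
  have : nm (f (z t) - f 0) <= 1 by apply: hd; rewrite [_ - _]subr0 nz.
  by have := le_normc_sub (f (z t)) (f 0); rewrite /M; lra.
have far a t : nm a < r / 2 -> r / 2 <= nm (z t - a).
  by have := le_normc_sub (z t) a; rewrite nz; lra.
have za a t : nm a < r / 2 -> z t - a != 0.
  by move=> /(far _ t) h; apply: contraTneq h => ->; rewrite Normc.normc0; lra.
have farV a t : nm a < r / 2 -> nm (z t - a)^-1 <= 2 / r.
  move=> ha; rewrite Normc.normcV -[2 / r]invf_div lef_pV2 ?posrE ?normc_gt0 ?za//; last by lra.
  exact: far.
pose ker n a t := f (z t) * (z t * (z t - a)^-1 ^+ n).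
have kerD n a : nm a < r / 2 -> exists v, is_mean (ker n a) v.
  move=> ha; apply: mean_exists => t.
  have [m hm] : exists m, cder f (z t) m by apply: hf; rewrite nz.
  have dz : vder z t (r%:C%C * ('i%C * cis t)) by rewrite zE; apply: vder_circle.
  have di : exists m', vder (fun t => (z t - a)^-1) t m'.
    eexists; apply: der_comp (derB dz (der_cst _ a _)) (cder_inv (za a t ha)).
  have [m' hm'] : exists m', vder (fun t => (z t - a)^-1 ^+ n) t m'.
    have [mi hmi] := di; elim: (n) => [|k [m' hm']]; first by exists 0; apply: der_cst.
    by eexists; apply: der_congr (derM hmi hm') _ _ => // s; rewrite exprS.
  by eexists; apply: derM (der_comp dz hm) (derM dz hm').
have [S hS] : {S : C -> C & forall a, nm a < r / 2 -> is_mean (ker 2%N a) (S a)}.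
  apply: (@choice C C (fun a v => nm a < r / 2 -> is_mean (ker 2%N a) v)) => a.
  by case: (ltP (nm a) (r / 2)) => [/(kerD 2%N)[v hv]|_]; [exists v|exists 0].
have cauchy a : nm a < r / 2 -> is_mean (ker 1%N a) (f a).
  move=> ha; apply: eq_mean (cauchy_formula r0 rrho hf (ltW ha)) _ _ => // t.
  by rewrite /ker zE expr1.
have df a : nm a < r / 2 -> cder f a (S a).
  move=> ha; pose e := r / 2 - nm a.
  (* From 1/(z-b) - 1/(z-a) - (b-a)/(z-a)^2 = (b-a)^2 / ((z-b)(z-a)^2), with |z| = r and each
     inverse at most 2 / r. *)
  apply: (@quadratic_der f a (S a) (M * (r * (2 / r) ^+ 3)) e); first by rewrite /e; lra.
  move=> b hb; have {}hb : nm b < r / 2.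
    by have := le_normc_sub b a; rewrite /e in hb; lra.
  have m1 := meanD (meanD (cauchy _ hb) (meanZ (-1) (cauchy _ ha))) (meanZ (- (b - a)) (hS _ ha)).
  have -> : f b - f a - S a * (b - a) = f b + -1 * f a + - (b - a) * S a by ring.
  apply: mean_bound m1 _ => t; rewrite /ker.
  have a0 := za a t ha; have b0 := za b t hb.
  set X := (X in nm X <= _).
  have -> : X = f (z t) * (z t * ((z t - b)^-1 * (z t - a)^-1 ^+ 2)) * (b - a) ^+ 2.
    by rewrite /X; field; rewrite a0 b0.
  rewrite !(normcX, Normc.normcM) nz ler_wpM2r ?sqr_ge0//.
  apply: ler_pM; rewrite ?normc_ge0 ?fM// ?mulr_ge0 ?exprn_ge0 ?normc_ge0 ?(ltW r0)//.
  rewrite ler_wpM2l ?(ltW r0)// [X in _ <= X]exprS.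
  apply: ler_pM; rewrite ?normc_ge0 ?exprn_ge0 ?normc_ge0 ?farV//.
  by rewrite lerXn2r ?nnegrE ?normc_ge0 ?farV//; apply: divr_ge0; lra.
have dS a : nm a < r / 2 -> exists l, cder S a l.
  move=> ha; have [T hT] := kerD 3%N a ha.
  exists (2 * T); pose e := r / 2 - nm a.
  (* The remainder of 1/(z-b)^2 is (b-a)^2 (3(z-a) - 2(b-a)) / ((z-b)^2 (z-a)^3), and 7 r is a crude
     bound for |3 z - 2 b - a|. *)
  apply: (@quadratic_der S a (2 * T) (M * (r * (7 * r * (2 / r) ^+ 5))) e); first by rewrite /e; lra.
  move=> b hb; have {}hb : nm b < r / 2.
    by have := le_normc_sub b a; rewrite /e in hb; lra.
  have m1 := meanD (meanD (hS _ hb) (meanZ (-1) (hS _ ha))) (meanZ (- (2 * (b - a))) hT).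
  have -> : S b - S a - 2 * T * (b - a) = S b + -1 * S a + - (2 * (b - a)) * T by ring.
  apply: mean_bound m1 _ => t; rewrite /ker.
  have a0 := za a t ha; have b0 := za b t hb.
  set X := (X in nm X <= _).
  have -> : X = f (z t) * (z t * ((3 * (z t - a) - 2 * (b - a)) *
      ((z t - b)^-1 ^+ 2 * (z t - a)^-1 ^+ 3))) * (b - a) ^+ 2.
    by rewrite /X; field; rewrite a0 b0.
  rewrite !(normcX, Normc.normcM) nz ler_wpM2r ?sqr_ge0//.
  apply: ler_pM; rewrite ?normc_ge0 ?fM// ?mulr_ge0 ?exprn_ge0 ?normc_ge0 ?(ltW r0)//.
  rewrite ler_wpM2l ?(ltW r0)//.
  apply: ler_pM; rewrite ?normc_ge0 ?mulr_ge0 ?exprn_ge0 ?normc_ge0//.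
    have -> : 3 * (z t - a) - 2 * (b - a) = 3%:R%:C%C * z t + (- (2%:R%:C%C * b) - a).
      by rewrite !rmorph_nat; ring.
    apply: (le_trans (le_normcD _ _)); rewrite Normc.normcM nz normc_real.
    have := le_normcD (- (2%:R%:C%C * b)) (- a).
    by rewrite !normcN Normc.normcM normc_real !normr_nat; lra.
  rewrite -[5%N]/(2 + 3)%N exprD.
  by apply: ler_pM; rewrite ?exprn_ge0 ?normc_ge0// lerXn2r ?nnegrE ?normc_ge0 ?farV//; apply: divr_ge0; lra.
exists (r / 2) => [|a ha]; first by lra.
have [l hl] := dS a ha; exists l; apply: eq_der hl.
exists (r / 2 - nm a) => [|w hw]; first by lra.
have {}hw : nm w < r / 2 by have := le_normc_sub w a; rewrite /= in hw; lra.
by rewrite (cder_derive1 (df _ hw)).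
Qed.

End Mean.

(** * Second-order expansions at the origin *)

Section Jets.
Variable R : realType.
Local Notation C := R[i].
Implicit Types (f g h k : C -> C) (a b c z : C).

Definition near0 (P : C -> Prop) :=
  exists2 d : R, 0 < d & forall z, z != 0 -> nm z < d -> P z.

Lemma near0_and P Q : near0 P -> near0 Q -> near0 (fun z => P z /\ Q z).
Proof.
move=> [d d0 hP] [e e0 hQ]; exists (Num.min d e) => [|z z0].
  by rewrite lt_min d0.
by rewrite lt_min => /andP[? ?]; split; [exact: hP|exact: hQ].
Qed.

Lemma near0_imp (P Q : C -> Prop) : near0 P ->
  (forall z, z != 0 -> P z -> Q z) -> near0 Q.
Proof. by move=> [d d0 hP] h; exists d => // z z0 /(hP _ z0)/(h _ z0). Qed.

Lemma near0_disc (r : R) : 0 < r -> near0 (fun z => nm z < r).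
Proof. by exists r. Qed.

Definition bounded0 h := exists K : R, near0 (fun z => nm (h z) <= K).

Lemma bounded0_cst c : bounded0 (fun=> c).
Proof. by exists (nm c); exists 1. Qed.

Lemma bounded0_id : bounded0 id.
Proof. by exists 1; exists 1 => // z _ /ltW. Qed.

Lemma bounded0D h k : bounded0 h -> bounded0 k -> bounded0 (fun z => h z + k z).
Proof.
move=> [K hK] [M hM]; exists (K + M); apply: near0_imp (near0_and hK hM) _.
by move=> z _ [? ?]; rewrite (le_trans (le_normcD _ _))// lerD.
Qed.

Lemma bounded0M h k : bounded0 h -> bounded0 k -> bounded0 (fun z => h z * k z).
Proof.
move=> [K hK] [M hM]; exists (K * M); apply: near0_imp (near0_and hK hM) _.
by move=> z _ [? ?]; rewrite Normc.normcM ler_pM ?normc_ge0.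
Qed.

Lemma near0_small k (e : R) : bounded0 k -> 0 < e -> near0 (fun z => nm (z * k z) < e).
Proof.
move=> [K hK] e0; have K0 : 0 < `|K| + 1 by have := normr_ge0 K; lra.
apply: near0_imp (near0_and hK (near0_disc (divr_gt0 e0 K0))) _ => z z0 [hk].
rewrite Normc.normcM ltr_pdivlMr//.
by apply: le_lt_trans; rewrite ler_wpM2l ?normc_ge0//; have := ler_norm K; lra.
Qed.

(* The origin is excluded so that quotients such as [f z / z] have jets. *)
Definition jet f a b c := exists2 h, bounded0 h &
  near0 (fun z => f z = a + b * z + c * z ^+ 2 + z ^+ 3 * h z).

Lemma jet_bound f a b c (K d : R) : 0 < d ->
  (forall z, z != 0 -> nm z < d ->
    nm (f z - (a + b * z + c * z ^+ 2)) <= K * nm z ^+ 3) -> jet f a b c.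
Proof.
move=> d0 hK; exists (fun z => (f z - (a + b * z + c * z ^+ 2)) / z ^+ 3).
  exists K; exists d => // z z0 /(hK _ z0) h.
  by rewrite Normc.normcM Normc.normcV normcX ler_pdivrMr ?exprn_gt0 ?normc_gt0.
by exists 1 => // z z0 _; field.
Qed.

Lemma eq_jet f g a b c a' b' c' : jet f a b c -> near0 (fun z => f z = g z) ->
  a = a' -> b = b' -> c = c' -> jet g a' b' c'.
Proof.
move=> [h bh hf] fg <- <- <-; exists h => //.
by apply: near0_imp (near0_and hf fg) _ => z _ [<- <-].
Qed.

Lemma jet_cst a : jet (fun=> a) a 0 0.
Proof.
by exists (fun=> 0); [exact: bounded0_cst|exists 1 => // z _ _; ring].
Qed.

Lemma jet_id : jet id 0 1 0.
Proof.
by exists (fun=> 0); [exact: bounded0_cst|exists 1 => // z _ _; rewrite /=; ring].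
Qed.

Lemma jetD f g a b c a' b' c' : jet f a b c -> jet g a' b' c' ->
  jet (fun z => f z + g z) (a + a') (b + b') (c + c').
Proof.
move=> [h bh hf] [k bk hg]; exists (fun z => h z + k z); first exact: bounded0D.
by apply: near0_imp (near0_and hf hg) _ => z _ [-> ->]; ring.
Qed.

Lemma jetM f g a b c a' b' c' : jet f a b c -> jet g a' b' c' ->
  jet (fun z => f z * g z) (a * a') (a * b' + b * a') (a * c' + b * b' + c * a').
Proof.
move=> [h bh hf] [k bk hg].
exists (fun z => (b * c' + c * b') + c * c' * z
   + ((a + (b * z + c * (z * z))) * k z + (a' + (b' * z + c' * (z * z))) * h z)
   + z * (z * (z * (h z * k z)))).
  have B x y w : bounded0 (fun z => x + (y * z + w * (z * z))).
    by repeat first [exact: bounded0_cst | exact: bounded0_id | apply: bounded0D | apply: bounded0M].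
  apply: bounded0D; first apply: bounded0D.
  - by apply: bounded0D; [exact: bounded0_cst|apply: bounded0M; [exact: bounded0_cst|exact: bounded0_id]].
  - by apply: bounded0D; apply: bounded0M => //; apply: B.
  - apply: bounded0M; first exact: bounded0_id.
    apply: bounded0M; first exact: bounded0_id.
    apply: bounded0M; first exact: bounded0_id.
    exact: bounded0M.
by apply: near0_imp (near0_and hf hg) _ => z _ [-> ->]; ring.
Qed.

Lemma jetZ x f a b c : jet f a b c -> jet (fun z => x * f z) (x * a) (x * b) (x * c).
Proof. by move=> hf; apply: eq_jet (jetM (jet_cst x) hf) _ _ _ _; [exists 1 => //| | |]; ring. Qed.

(** A jet ignores the value at the origin, so [g 0] has to be known if f vanishes at points
    arbitrarily close to 0. *)
Lemma jet_comp g f a b c p q : jet g a b c -> jet f 0 p q ->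
  near0 (fun z => f z = 0 -> g 0 = a) ->
  jet (fun z => g (f z)) a (b * p) (b * q + c * p ^+ 2).
Proof.
move=> [k [K [d d0 hK]] [d' d'0 hg]] [h bh hf] g0.
pose v z := q + z * h z; pose u z := p + z * v z.
have bv : bounded0 v.
  by apply: bounded0D; [exact: bounded0_cst|apply: bounded0M => //; exact: bounded0_id].
have bu : bounded0 u.
  by apply: bounded0D; [exact: bounded0_cst|apply: bounded0M => //; exact: bounded0_id].
have fu : near0 (fun z => f z = z * u z).
  by apply: near0_imp hf _ => z _ ->; rewrite /u /v; ring.
have small (e : R) : 0 < e -> near0 (fun z => nm (f z) < e).
  move=> e0; apply: near0_imp (near0_and fu (near0_small bu e0)) _ => z _ [-> //].
(* The remainder [k] is controlled only off the origin; at zeros of f it is replaced by 0. *)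
have bk : bounded0 (fun z => if f z == 0 then 0 else k (f z)).
  exists `|K|; apply: near0_imp (small _ d0) _ => z _ hz; case: eqVneq => fz.
    by rewrite Normc.normc0.
  by apply: le_trans (hK _ fz hz) (ler_norm _).
exists (fun z => b * h z + c * (2 * p * v z + z * (v z * v z))
    + u z * (u z * u z) * (if f z == 0 then 0 else k (f z))).
  have bb x : bounded0 (fun=> x) := bounded0_cst x.
  have bi := bounded0_id.
  apply: bounded0D; last by apply: bounded0M => //; apply: bounded0M => //; apply: bounded0M.
  apply: bounded0D; first exact: bounded0M.
  apply: bounded0M => //; apply: bounded0D; first exact: bounded0M.
  by apply: bounded0M => //; apply: bounded0M.
apply: near0_imp (near0_and (near0_and hf fu) (near0_and (small _ d'0) g0)) _.
move=> z z0 [[hz fz] [sz gz]].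
suff -> : g (f z) = a + b * f z + c * f z ^+ 2 +
    f z ^+ 3 * (if f z == 0 then 0 else k (f z)).
  rewrite {2}fz {2}fz {1}hz; set X := if _ then _ else _.
  by rewrite /u /v; ring.
case: eqVneq => [f0|fn0]; last exact: hg.
by rewrite f0 gz//; ring.
Qed.

Lemma near0_cst_eq0 a k : bounded0 k -> near0 (fun z => a + z * k z = 0) -> a = 0.
Proof.
move=> hk h; apply: normc_eq0P => e e0.
have [d d0 hd] := near0_and h (near0_small hk e0).
have z0 := real_neq0 (divr_gt0 d0 (ltr0Sn R 1)).
have [|h1 h2] := hd (d / 2)%:C%C z0.
  by rewrite normc_real gtr0_norm; lra.
have -> : a = - ((d / 2)%:C%C * k (d / 2)%:C%C) by apply/eqP; rewrite -addr_eq0 h1.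
by rewrite normcN ltW.
Qed.

Lemma jet_neq0 f a b c : jet f a b c -> a != 0 -> near0 (fun z => f z != 0).
Proof.
move=> [h bh hf] a0; have bi := bounded0_id; have bb x : bounded0 (fun=> x) := bounded0_cst x.
have bk : bounded0 (fun z => b + z * (c + z * h z)).
  by apply: bounded0D => //; apply: bounded0M => //; apply: bounded0D => //; apply: bounded0M.
apply: near0_imp (near0_and hf (near0_small bk (normc_gt0 a0))) _ => z z0 [fz].
apply: contraTneq => f0; rewrite -leNgt -[X in X <= _]normcN.
have -> : - a = z * (b + z * (c + z * h z)) - f z by rewrite fz; ring.
by rewrite f0 subr0.
Qed.

Lemma jet_eq0 a b c : jet (fun=> 0) a b c -> [/\ a = 0, b = 0 & c = 0].
Proof.
move=> [h bh hz]; have bi := bounded0_id; have bb x : bounded0 (fun=> x) := bounded0_cst x.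
have a0 : a = 0.
  apply: (near0_cst_eq0 (k := fun z => b + z * (c + z * h z))).
    by apply: bounded0D => //; apply: bounded0M => //; apply: bounded0D => //; apply: bounded0M.
  by apply: near0_imp hz _ => z z0 ->; ring.
have b0 : b = 0.
  apply: (near0_cst_eq0 (k := fun z => c + z * h z)).
    by apply: bounded0D => //; apply: bounded0M.
  apply: near0_imp hz _ => z z0 e; apply: (mulfI z0).
  by rewrite mulr0 [RHS]e a0; ring.
split=> //; apply: (near0_cst_eq0 (k := h)) => //.
apply: near0_imp hz _ => z z0 e; apply: (mulfI (expf_neq0 2 z0)).
by rewrite mulr0 [RHS]e a0 b0; ring.
Qed.

Lemma jet_unique f a b c a' b' c' : jet f a b c -> jet f a' b' c' ->
  [/\ a = a', b = b' & c = c'].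
Proof.
move=> h h'; have [|e1 e2 e3] := @jet_eq0 (a + -1 * a') (b + -1 * b') (c + -1 * c').
  by apply: eq_jet (jetD h (jetZ (-1) h')) _ _ _ _ => //; exists 1 => // z _ _; ring.
by split; apply/eqP; rewrite -subr_eq0 -mulN1r ?e1 ?e2 ?e3.
Qed.

Definition holo0 f := exists2 d : R, 0 < d & forall z, nm z < d -> exists l, cder f z l.

Lemma holo0_derive f : holo0 f -> holo0 (derive1 f).
Proof. by move=> [d d0 hf]; apply: derivative_differentiable hf. Qed.

Lemma holo0_cder f : holo0 f ->
  exists2 d : R, 0 < d & forall z, nm z < d -> cder f z (derive1 f z).
Proof.
move=> [d d0 hf]; exists d => // z /hf[l hl].
by rewrite (cder_derive1 hl).
Qed.

(** Mean value inequality along the segment from 0 to z. The factor 1/(n+1) of exact integration is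
    given up, since only the order of the remainder matters. *)
Lemma integral_bound (G G' : C -> C) (K d : R) n : 0 <= K ->
  (forall z, nm z < d -> cder G z (G' z)) ->
  (forall z, nm z < d -> nm (G' z) <= K * nm z ^+ n) ->
  forall z, nm z < d -> nm (G z - G 0) <= K * nm z ^+ n.+1.
Proof.
move=> K0 dG hK z zd.
have seg (t : R) : 0 <= t <= 1 -> nm (z * t%:C%C) <= nm z.
  move=> /andP[t0 t1]; rewrite Normc.normcM normc_real ger0_norm//.
  by rewrite ler_piMr ?normc_ge0.
have dz (t : R) : vder (fun s => z * s%:C%C) t z.
  by have := derZ z (der_id (real_complex R) t); rewrite mulr1.
have := @vder_bound _ (fun t => G (z * t%:C%C)) (fun t => G' (z * t%:C%C) * z)
   0 1 (K * nm z ^+ n.+1) ler01.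
rewrite rmorph1 rmorph0 mulr1 mulr0 subr0 mulr1; apply => t ht.
  by apply: der_comp (dz t) (dG _ _); apply: le_lt_trans (seg _ ht) zd.
rewrite Normc.normcM exprSr mulrA ler_wpM2r ?normc_ge0//.
apply: (le_trans (hK _ (le_lt_trans (seg _ ht) zd))).
by rewrite ler_wpM2l// lerXn2r ?nnegrE ?normc_ge0// seg.
Qed.

Lemma holo0_bounded f : holo0 f -> exists K d : R,
  [/\ 0 <= K, 0 < d & forall z, nm z < d -> nm (f z) <= K].
Proof.
move=> [e e0 /(_ 0)]; rewrite Normc.normc0 => /(_ e0)[l hc].
have [d dp hd] := der_vanishing hc ltr01.
exists (nm (f 0) + 1); exists d; split=> // [|z zd].
  by have := normc_ge0 (f 0); lra.
have : nm (f z - f 0) <= 1 by apply: hd; rewrite [_ - _]subr0.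
by have := le_normc_sub (f z) (f 0); lra.
Qed.

Definition derivative0 f g := exists2 d : R, 0 < d & forall z, nm z < d -> cder f z (g z).

Lemma taylor2_bound f f1 f2 f3 :
  derivative0 f f1 -> derivative0 f1 f2 -> derivative0 f2 f3 ->
  (exists K d : R, [/\ 0 <= K, 0 < d & forall z, nm z < d -> nm (f3 z) <= K]) ->
  exists K d : R, [/\ 0 <= K, 0 < d & forall z, nm z < d ->
    nm (f z - (f 0 + f1 0 * z + f2 0 / 2 * z ^+ 2)) <= K * nm z ^+ 3].
Proof.
move=> [d0 d0p H0] [d1 d1p H1] [d2 d2p H2] [K [d3 [K0 d3p H3]]].
exists K; exists (Num.min (Num.min d0 d1) (Num.min d2 d3)).
set d := Num.min _ _.
have hd z : nm z < d -> [/\ nm z < d0, nm z < d1, nm z < d2 & nm z < d3].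
  by rewrite !lt_min => /andP[/andP[? ?] /andP[? ?]].
split=> //; first by rewrite !lt_min d0p d1p d2p d3p.
have b2 : forall z, nm z < d -> nm (f2 z - f2 0) <= K * nm z ^+ 1.
  apply: (integral_bound (G' := f3) (n := 0)) => // z /hd[? ? ? ?].
    exact: H2.
  by rewrite expr0 mulr1; apply: H3.
have b1 : forall z, nm z < d -> nm (f1 z - f1 0 - f2 0 * z) <= K * nm z ^+ 2.
  move=> z zd.
  have := @integral_bound (fun z => f1 z - f2 0 * z) (fun z => f2 z - f2 0) K d 1 K0.
  move=> /(_ _ b2 z zd).
  have -> : f1 z - f2 0 * z - (f1 0 - f2 0 * 0) = f1 z - f1 0 - f2 0 * z by ring.
  apply => w /hd[? ? ? ?].
  by have := derB (H1 w _) (derZ (f2 0) (der_id id w)); rewrite mulr1; apply.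
move=> z zd.
have := @integral_bound (fun z => f z - f1 0 * z - f2 0 / 2 * (z * z))
  (fun z => f1 z - f1 0 - f2 0 * z) K d 2 K0.
move=> /(_ _ b1 z zd).
have -> : f z - f1 0 * z - f2 0 / 2 * (z * z) - (f 0 - f1 0 * 0 - f2 0 / 2 * (0 * 0)) =
  f z - (f 0 + f1 0 * z + f2 0 / 2 * z ^+ 2) by ring.
apply => w /hd[? ? ? ?].
apply: der_congr (derB (derB (H0 w _) (derZ (f1 0) (der_id id w)))
  (derZ (f2 0 / 2) (derM (der_id id w) (der_id id w)))) _ _ => //.
by rewrite /=; field.
Qed.

Lemma taylor3_bound f f1 f2 f3 : derivative0 f f1 ->
  (exists K d : R, [/\ 0 <= K, 0 < d & forall z, nm z < d ->
    nm (f1 z - (f1 0 + f2 0 * z + f3 0 / 2 * z ^+ 2)) <= K * nm z ^+ 3]) ->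
  exists K d : R, [/\ 0 <= K, 0 < d & forall z, nm z < d ->
    nm (f z - (f 0 + f1 0 * z + f2 0 / 2 * z ^+ 2 + f3 0 / 6 * z ^+ 3)) <= K * nm z ^+ 4].
Proof.
move=> [d0 d0p H0] [K [d [K0 dp H]]].
exists K; exists (Num.min d0 d); split=> //; first by rewrite lt_min d0p.
move=> z zd.
have dg w : nm w < Num.min d0 d ->
    cder (fun z => f z - f1 0 * z - f2 0 / 2 * (z * z) - f3 0 / 6 * (z * (z * z))) w
      (f1 w - (f1 0 + f2 0 * w + f3 0 / 2 * w ^+ 2)).
  rewrite lt_min => /andP[w1 w2]; have di := der_id id w.
  apply: der_congr (derB (derB (derB (H0 w w1) (derZ (f1 0) di))
    (derZ (f2 0 / 2) (derM di di))) (derZ (f3 0 / 6) (derM di (derM di di)))) _ _ => //.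
  by rewrite /=; field.
have := integral_bound K0 dg _ zd.
have -> : f z - f1 0 * z - f2 0 / 2 * (z * z) - f3 0 / 6 * (z * (z * z)) -
   (f 0 - f1 0 * 0 - f2 0 / 2 * (0 * 0) - f3 0 / 6 * (0 * (0 * 0))) =
  f z - (f 0 + f1 0 * z + f2 0 / 2 * z ^+ 2 + f3 0 / 6 * z ^+ 3) by ring.
by apply => w; rewrite lt_min => /andP[w1 w2]; apply: H.
Qed.

Lemma holo0_taylor2 f : holo0 f -> exists K d : R, [/\ 0 <= K, 0 < d &
  forall z, nm z < d -> nm (f z - (f 0 + derive1 f 0 * z +
    derive1 (derive1 f) 0 / 2 * z ^+ 2)) <= K * nm z ^+ 3].
Proof.
move=> h0; have h1 := holo0_derive h0; have h2 := holo0_derive h1.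
exact: taylor2_bound (holo0_cder h0) (holo0_cder h1) (holo0_cder h2)
  (holo0_bounded (holo0_derive h2)).
Qed.

Lemma holo0_taylor3 f : holo0 f -> exists K d : R, [/\ 0 <= K, 0 < d &
  forall z, nm z < d -> nm (f z - (f 0 + derive1 f 0 * z +
    derive1 (derive1 f) 0 / 2 * z ^+ 2 +
    derive1 (derive1 (derive1 f)) 0 / 6 * z ^+ 3)) <= K * nm z ^+ 4].
Proof.
by move=> h0; apply: taylor3_bound (holo0_cder h0) (holo0_taylor2 (holo0_derive h0)).
Qed.

Lemma holo0_jet f : holo0 f ->
  jet f (f 0) (derive1 f 0) (derive1 (derive1 f) 0 / 2).
Proof.
move=> /holo0_taylor2[K [d [K0 dp H]]]; apply: (jet_bound (K := K) dp) => z _.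
exact: H.
Qed.

(** Division by z costs one order, hence the remainder of order 4 in the hypothesis. *)
Lemma quotient_jet f a b c : f 0 = 0 ->
  (exists K d : R, [/\ 0 <= K, 0 < d & forall z, nm z < d ->
    nm (f z - (f 0 + a * z + b * z ^+ 2 + c * z ^+ 3)) <= K * nm z ^+ 4]) ->
  jet (fun z => f z / z) a b c.
Proof.
move=> f0 [K [d [K0 dp H]]]; apply: (jet_bound (K := K) dp) => z z0 /H.
rewrite f0 add0r.
have -> : f z - (a * z + b * z ^+ 2 + c * z ^+ 3) =
  z * (f z / z - (a + b * z + c * z ^+ 2)) by field.
by rewrite Normc.normcM [nm z ^+ 4]exprS [K * _]mulrCA ler_pM2l ?normc_gt0.
Qed.

Lemma holo0_quotient_jet f : holo0 f -> f 0 = 0 ->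
  jet (fun z => f z / z) (derive1 f 0) (derive1 (derive1 f) 0 / 2)
    (derive1 (derive1 (derive1 f)) 0 / 6).
Proof. by move=> /holo0_taylor3 h f0; apply: quotient_jet. Qed.

(** The mean of w(r e^(it)) e^(-2it) is w2 r^2: the part of degree at least 3 is z^3 k(z) and
    contributes 0 by [mean_closed], and the linear term leaves e^(-it), of mean 0. Since |w| < 1,
    r^2 |w2| <= 1 for every r < 1. *)
Lemma schwarz_taylor_coef2 (w : C -> C) (w1 w2 w3 : C) :
  (forall z, nm z < 1 -> exists l, cder w z l) -> w 0 = 0 ->
  (forall z, nm z < 1 -> nm (w z) < 1) ->
  (exists K d : R, [/\ 0 <= K, 0 < d & forall z, nm z < d ->
    nm (w z - (w 0 + w1 * z + w2 * z ^+ 2 + w3 * z ^+ 3)) <= K * nm z ^+ 4]) ->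
  nm w2 <= 1.
Proof.
move=> hw w0 wb [K [d [K0 dp H]]]; rewrite w0 in H.
(* The value w3 makes k continuous at 0, its only possibly singular point. *)
pose k z := if z == 0 then w3 else (w z - w1 * z - w2 * z ^+ 2) / z ^+ 3.
have kc : vanishing id 0 (fun z => k z - k 0).
  move=> e e0; have K1 : 0 < K + 1 by lra.
  exists (Num.min d (e / (K + 1))) => [|z]; first by rewrite lt_min dp divr_gt0.
  rewrite [_ - _]subr0 lt_min ltr_pdivlMr// => /andP[/H h he].
  rewrite /k eqxx; case: eqVneq => [_|z0]; first by rewrite subrr Normc.normc0 ltW.
  have -> : (w z - w1 * z - w2 * z ^+ 2) / z ^+ 3 - w3 =
    (w z - (0 + w1 * z + w2 * z ^+ 2 + w3 * z ^+ 3)) / z ^+ 3 by field.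
  rewrite Normc.normcM Normc.normcV normcX ler_pdivrMr ?exprn_gt0 ?normc_gt0//.
  apply: (le_trans h); rewrite [nm z ^+ 4]exprS [K * _]mulrA ler_wpM2r ?exprn_ge0 ?normc_ge0//.
  by rewrite /= in he *; have := normc_ge0 z; nra.
have kd z : nm z < 1 -> z != 0 -> exists l, cder k z l.
  move=> /hw[m hm] z0; have di := der_id id z.
  have z30 : z * (z * z) != 0 by rewrite !mulf_neq0.
  eexists; apply: eq_der (derM (derB (derB hm (derZ w1 di)) (derZ w2 (derM di di)))
    (der_comp (derM di (derM di di)) (cder_inv z30))).
  exists (nm z) => [|u hu]; first exact: normc_gt0.
  rewrite /k; case: eqVneq => [u0|_]; last by rewrite /= !exprS expr0 !mulr1.
  by move: hu; rewrite u0 [_ - _]sub0r normcN ltxx.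
have bnd r : 0 < r -> r < 1 -> r ^+ 2 * nm w2 <= 1.
  move=> r0 r1; have rn := real_neq0 r0.
  have m0 := mean_closed r0 r1 kd kc.
  have m1 : is_mean (@cis R) 0.
    have lt12 : 1 < 2 :> R by lra.
    apply: eq_mean (@mean_closed R (fun=> 1) 0 1 2 ltr01 lt12 _ _) _ _ => //.
    - by move=> z _ _; exists 0; apply: der_cst.
    - by apply: der_vanishing (der_cst _ _ _).
    - by move=> t; rewrite mulr1.
  have m2 := meanD (meanZ (r%:C%C ^+ 3) m0) (meanD (meanZ (w1 * r%:C%C) (mean_conj m1))
    (mean_cst (w2 * r%:C%C ^+ 2))).
  have m3 : is_mean (fun t => w (r%:C%C * cis t) * (cis t)^-1 ^+ 2) (w2 * r%:C%C ^+ 2).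
    apply: eq_mean m2 _ _ => [t|]; last by rewrite !mulr0 add0r conjc0 mulr0 add0r.
    have ct := cis_neq0 t; have zn : r%:C%C * cis t != 0 by rewrite mulf_neq0.
    by rewrite conj_cis /k (negbTE zn); field; rewrite ct rn.
  have : nm (w2 * r%:C%C ^+ 2) <= 1.
    apply: mean_bound m3 _ => t.
    rewrite Normc.normcM normcX Normc.normcV normc_cis invr1 expr1n mulr1.
    by rewrite ltW// wb// normc_circle.
  by rewrite Normc.normcM normcX normc_real gtr0_norm// mulrC.
rewrite leNgt; apply/negP => n1; set n := nm w2 in bnd n1.
have n0 : 0 < n by lra.
(* If n = |w2| > 1, this radius is below 1 and r^2 n = (n + 1)^2 / (4 n) > 1, because (n - 1)^2 >
   0. *)
have r0 : 0 < (n + 1) / (2 * n) by apply: divr_gt0; lra.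
have r1 : (n + 1) / (2 * n) < 1 by rewrite ltr_pdivrMr; lra.
have := bnd _ r0 r1; apply/negP; rewrite -ltNge.
have -> : ((n + 1) / (2 * n)) ^+ 2 * n = (n + 1) ^+ 2 / (4 * n) by field; rewrite lt0r_neq0.
by rewrite ltr_pdivlMr; [nra|lra].
Qed.

Lemma schwarz_coef2 (w : C -> C) :
  (forall z, nm z < 1 -> exists l, cder w z l) -> w 0 = 0 ->
  (forall z, nm z < 1 -> nm (w z) < 1) -> nm (derive1 (derive1 w) 0 / 2) <= 1.
Proof.
move=> hw w0 wb; have h0 : holo0 w by exists 1.
exact: schwarz_taylor_coef2 hw w0 wb (holo0_taylor3 h0).
Qed.

Lemma cexpE (z : C) : cexp z = (expR (complex.Re z))%:C%C * cis (complex.Im z).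
Proof. by []. Qed.

Lemma cisD (x y : R) : cis (x + y) = cis x * cis y.
Proof.
by apply/eqP; rewrite eq_complex /= cosD sinD [sin x * _ + _]addrC !eqxx.
Qed.

Lemma cexpD (z w : C) : cexp (z + w) = cexp z * cexp w.
Proof.
rewrite !cexpE; have -> : complex.Re (z + w) = complex.Re z + complex.Re w.
  by case: z; case: w.
have -> : complex.Im (z + w) = complex.Im z + complex.Im w by case: z; case: w.
by rewrite expRD cisD rmorphM mulrACA.
Qed.

Lemma cexp0 : cexp (0 : C) = 1.
Proof. by rewrite cexpE /= expR0 cis0 mulr1. Qed.

(** With w = x + i y, the remainder splits into those of e^x and cis y, each o(|w|), plus the
    product x (cis y - 1). Other points follow from the functional equation. *)
Lemma cder_cexp0 : cder (@cexp R) 0 1.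
Proof.
have dE : vder (fun x : R => (expR x)%:C%C) 0 1.
  have := is_derive_vder (is_derive_expR (0 : R)) (is_derive_cst (0 : R) (0 : R) 1).
  by rewrite expR0.
have dC := vder_cis (0 : R); rewrite cis0 mulr1 in dC.
move=> e e0; have e3 : 0 < e / 3 by lra.
have [d1 d1p h1] := dE _ e3; have [d2 d2p h2] := dC _ e3.
have [d3 d3p h3] := der_vanishing dC e3.
exists (Num.min d1 (Num.min d2 d3)) => [|w]; first by rewrite !lt_min d1p d2p.
rewrite [_ - _]subr0 cexp0 !lt_min mul1r => /and3P[w1 w2 w3].
set x := complex.Re w; set y := complex.Im w.
have wE : w = x%:C%C + 'i%C * y%:C%C by rewrite {1}[w]complexE.
have xw : `|x| <= nm w := ge_Re_normc w.
have yw : `|y| <= nm w := ge_Im_normc w.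
have b1 : nm ((expR x)%:C%C - 1 - x%:C%C) <= e / 3 * `|x|.
  have := h1 x; rewrite [x%:C%C - _]subr0 normc_real expR0 mul1r.
  by apply; apply: le_lt_trans w1.
have b2 : nm (cis y - 1 - 'i%C * y%:C%C) <= e / 3 * `|y|.
  have := h2 y; rewrite [y%:C%C - _]subr0 normc_real cis0.
  by apply; apply: le_lt_trans w2.
have b3 : nm (cis y - 1) <= e / 3.
  have := h3 y; rewrite [y%:C%C - _]subr0 normc_real cis0.
  by apply; apply: le_lt_trans w3.
have -> : cexp w - 1 - w = ((expR x)%:C%C - 1 - x%:C%C) * cis y +
    (cis y - 1 - 'i%C * y%:C%C) + x%:C%C * (cis y - 1).
  by rewrite cexpE -/x -/y {1}wE; ring.
apply: (le_trans (le_normcD _ _)); apply: (le_trans (lerD (le_normcD _ _) (lexx _))).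
rewrite !Normc.normcM normc_cis mulr1 normc_real.
have b1' : nm ((expR x)%:C%C - 1 - x%:C%C) <= e / 3 * nm w.
  by apply: (le_trans b1); rewrite ler_wpM2l ?(ltW e3).
have b2' : nm (cis y - 1 - 'i%C * y%:C%C) <= e / 3 * nm w.
  by apply: (le_trans b2); rewrite ler_wpM2l ?(ltW e3).
have b3' : `|x| * nm (cis y - 1) <= nm w * (e / 3).
  by apply: ler_pM; rewrite ?normc_ge0.
lra.
Qed.

Lemma cder_cexp (z : C) : cder (@cexp R) z (cexp z).
Proof.
have ds : cder (fun w => w - z) z (1 - 0) by apply: derB (der_id _ _) (der_cst _ _ _).
have dc := cder_cexp0; rewrite -[X in cder _ X](subrr z) in dc.
apply: der_congr (derZ (cexp z) (der_comp ds dc)) _ _ => [w|].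
  by rewrite -cexpD addrC subrK.
by rewrite subr0 !mulr1.
Qed.

Lemma derive_cexp : derive1 (@cexp R) = @cexp R.
Proof. by apply/funext => z; apply: cder_derive1 (cder_cexp z). Qed.

Lemma jet_cexp : jet (@cexp R) 1 1 2^-1.
Proof.
have h : holo0 (@cexp R) by exists 1 => // z _; exists (cexp z); apply: cder_cexp.
by have := holo0_jet h; rewrite !derive_cexp cexp0 div1r.
Qed.

End Jets.

(** * Coefficient identities *)

Section Coefficients.
Variable R : realType.
Local Notation C := R[i].
Implicit Types (f g h L : C -> C).

Lemma real_complexD (x y : R) : (x + y)%:C%C = x%:C%C + y%:C%C.
Proof. exact: rmorphD. Qed.

Lemma real_complexM (x y : R) : (x * y)%:C%C = x%:C%C * y%:C%C.
Proof. exact: rmorphM. Qed.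

Lemma real_complex_nat n : (n%:R : R)%:C%C = n%:R.
Proof. exact: rmorph_nat. Qed.

Lemma norm_lt1E (z : C) : (`|z| < 1) = (nm z < 1).
Proof. by rewrite norm_normc -[1 in LHS](rmorph1 (real_complex R)) ltcR. Qed.

Lemma analytic_cder f : analytic_U f -> forall z, nm z < 1 -> exists l, cder f z l.
Proof.
move=> hf z; rewrite -norm_lt1E => /hf/derivable_cder h.
by exists (derive1 f z).
Qed.

Lemma analytic_holo0 f : analytic_U f -> holo0 f.
Proof. by move=> /analytic_cder hf; exists 1. Qed.

Lemma near_near0 (P : C -> Prop) : (\forall z \near (0 : C), P z) -> near0 P.
Proof.
move=> /nbhs_ballP[e /= e0 he].
have er : e = (complex.Re e)%:C%C by rewrite RRe_real// gtr0_real.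
exists (complex.Re e) => [|z _ ze]; first by rewrite -ltcR -er.
by apply: he; rewrite /ball /= sub0r normrN norm_normc er ltcR.
Qed.

Lemma jet_cexpZ L l1 l2 c : jet L 0 l1 l2 ->
  jet (fun z => cexp (c * L z)) 1 (c * l1) (c * l2 + (c * l1) ^+ 2 / 2).
Proof.
move=> hL; have cL : jet (fun z => c * L z) 0 (c * l1) (c * l2).
  by apply: eq_jet (jetZ c hL) _ _ _ _ => //; [exists 1|rewrite mulr0].
apply: eq_jet (jet_comp (jet_cexp R) cL _) _ _ _ _ => //.
- by exists 1 => // z _ _ _; rewrite cexp0.
- by exists 1.
- by rewrite mul1r.
- by rewrite mul1r [_ / 2]mulrC.
Qed.

(** Comparing the jets of [cexp (L z)] and h(z) / z gives l1 = a2 and l2 = a3 - a2^2 / 2, after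
    which both powers expand through [jet_cexpZ]. The coefficient [e] of h'' is multiplied by z and
    leaves order 2. *)
Lemma jet_Phi (lam mu del : R) h L (a2 a3 e l1 l2 : C) :
  jet (fun z => h z / z) 1 a2 a3 -> jet (derive1 h) 1 (2 * a2) (3 * a3) ->
  jet (derive1 (derive1 h)) (2 * a2) (6 * a3) e ->
  jet L 0 l1 l2 -> near0 (fun z => cexp (L z) = h z / z) ->
  jet (Phi lam mu del h L) 1
    ((lam + mu + 2 * xi lam mu * del)%:C%C * a2)
    ((2 * lam + mu + 6 * xi lam mu * del)%:C%C * a3
      + ((mu - 1) * (2 * lam + mu) / 2)%:C%C * a2 ^+ 2).
Proof.
move=> hq h1 h2 hL hexp; set x := xi lam mu.
have [_ e1 e2] : [/\ 1 = 1 :> C, l1 = a2 & l2 + l1 ^+ 2 / 2 = a3].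
  apply: jet_unique _ hq; apply: eq_jet (jet_cexpZ 1 hL) _ _ _ _ => //.
  - by apply: near0_imp hexp _ => z _ <-; rewrite mul1r.
  - by rewrite mul1r.
  - by rewrite !mul1r.
have el2 : l2 = a3 - a2 ^+ 2 / 2 by rewrite -e2 e1 addrK.
have j1 := jetZ (1 - lam%:C%C) (jet_cexpZ mu%:C%C hL).
have j2 := jetM (jetZ lam%:C%C h1) (jet_cexpZ (mu%:C%C - 1) hL).
have j3 := jetM (jetZ (x * del)%:C%C (jet_id R)) h2.
apply: eq_jet (jetD (jetD j1 j2) j3) _ _ _ _.
- by exists 1.
- by ring.
- rewrite -[2 * x * del]mulrA real_complexD (real_complexD lam) (real_complexM 2).
  by rewrite real_complex_nat e1; ring.
- rewrite -[6 * x * del]mulrA real_complexD (real_complexD (2 * lam)) (real_complexM 6).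
  rewrite (real_complexM _ 2^-1) fmorphV (real_complexM (mu - 1)) (real_complexD mu).
  rewrite (real_complexD (2 * lam)) (real_complexM 2) !real_complex_nat rmorphN1 el2 e1.
  by field.
Qed.

(** The generating function is not expanded: the jet of (1 - 2 t w + w^2) F is compared with that of
    1. The factors 2 t and 4 t^2 - 1 are U_1(t) and U_2(t). *)
Lemma subordinate_Hcheb_coef (t : R) F (p1 p2 : C) : jet F 1 p1 p2 ->
  subordinate F (Hcheb t) -> exists c1 c2 : C, [/\ nm c2 <= 1,
    p1 = 2 * t%:C%C * c1 &
    p2 = 2 * t%:C%C * c2 + (4 * t%:C%C ^+ 2 - 1) * c1 ^+ 2].
Proof.
move=> hF [w [aw [w0 [wb Fw]]]].
have hw := holo0_jet (analytic_holo0 aw); rewrite w0 in hw.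
have wS : nm (derive1 (derive1 w) 0 / 2) <= 1.
  apply: schwarz_coef2 => //; first exact: analytic_cder.
  by move=> z; rewrite -!norm_lt1E; apply: wb.
move: (derive1 w 0) (derive1 (derive1 w) 0 / 2) hw wS => c1 c2 hw wS.
exists c1, c2.
have jq := jetD (jetD (jet_cst 1) (jetZ (- (2 * t%:C%C)) hw)) (jetM hw hw).
have ne := jet_neq0 jq; rewrite !mulr0 !addr0 oner_neq0 in ne; have {}ne := ne isT.
have : jet (fun z => (1 + - (2 * t%:C%C) * w z + w z * w z) * F z) 1 0 0.
  apply: eq_jet (jet_cst 1) _ _ _ _ => //.
  apply: near0_imp (near0_and ne (near0_disc (@ltr01 R))) _ => z z0 [zn z1].
  rewrite Fw ?norm_lt1E// /Hcheb.
  have -> : 1 - 2%:R * t%:C%C * w z + w z ^+ 2 = 1 + - (2 * t%:C%C) * w z + w z * w z by ring.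
  by rewrite mulfV.
move=> /(jet_unique (jetM jq hF))[_ e1 e2].
have p1E : p1 = 2 * t%:C%C * c1.
  by apply/eqP; rewrite -subr_eq0 -e1; apply/eqP; ring.
split=> //; rewrite p1E in e2.
by apply/eqP; rewrite -subr_eq0 -e2; apply/eqP; ring.
Qed.

End Coefficients.

(** * Coefficients of the inverse function and the Fekete-Szego bound *)

Section Main.
Variable R : realType.
Local Notation C := R[i].
Implicit Types (f g L : C -> C).

Lemma xi_ge0 (lam mu : R) : 1 <= lam -> 0 <= mu -> 0 <= xi lam mu.
Proof. by move=> l1 m0; apply: divr_ge0; lra. Qed.

Lemma derive2_coef2 f : derive1 (derive1 f) 0 = 2 * coef2 f.
Proof. by rewrite /coef2 mulrC divfK// pnatr_eq0. Qed.

Lemma derive3_coef3 f : derive1 (derive1 (derive1 f)) 0 = 6 * coef3 f.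
Proof. by rewrite /coef3 mulrC divfK// pnatr_eq0. Qed.

Lemma quotient_coef_jet f : analytic_U f -> f 0 = 0 -> derive1 f 0 = 1 ->
  jet (fun z => f z / z) 1 (coef2 f) (coef3 f).
Proof.
move=> /analytic_holo0 hf f0 f1.
by apply: eq_jet (holo0_quotient_jet hf f0) _ f1 (erefl _) (erefl _); exists 1.
Qed.

Lemma coef_jet f : analytic_U f -> f 0 = 0 -> derive1 f 0 = 1 -> jet f 0 1 (coef2 f).
Proof.
move=> /analytic_holo0 hf f0 f1.
by apply: eq_jet (holo0_jet hf) _ f0 f1 (erefl _); exists 1.
Qed.

Lemma Phi_coef (lam mu del t : R) f L : analytic_U f -> f 0 = 0 -> derive1 f 0 = 1 ->
  log_quot f L -> subordinate (Phi lam mu del f L) (Hcheb t) ->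
  exists c1 c2 : C, [/\ nm c2 <= 1,
    (lam + mu + 2 * xi lam mu * del)%:C%C * coef2 f = 2 * t%:C%C * c1 &
    (2 * lam + mu + 6 * xi lam mu * del)%:C%C * coef3 f
      + ((mu - 1) * (2 * lam + mu) / 2)%:C%C * coef2 f ^+ 2
    = 2 * t%:C%C * c2 + (4 * t%:C%C ^+ 2 - 1) * c1 ^+ 2].
Proof.
move=> af f0 f1 [aL [L0 eL]] sub.
have h0 := analytic_holo0 af; have h1 := holo0_derive h0; have h2 := holo0_derive h1.
have jL := holo0_jet (analytic_holo0 aL); rewrite L0 in jL.
have j1 : jet (derive1 f) 1 (2 * coef2 f) (3 * coef3 f).
  apply: eq_jet (holo0_jet h1) _ f1 (derive2_coef2 f) _; first by exists 1.
  by rewrite derive3_coef3; field.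
have [e j2] : exists e, jet (derive1 (derive1 f)) (2 * coef2 f) (6 * coef3 f) e.
  eexists; apply: eq_jet (holo0_jet h2) _ (derive2_coef2 f) (derive3_coef3 f) (erefl _).
  by exists 1.
have nL : near0 (fun z => cexp (L z) = f z / z).
  by exists 1 => // z z0 z1; apply: eL; rewrite ?norm_lt1E.
have jP := jet_Phi lam mu del (quotient_coef_jet af f0 f1) j1 j2 jL nL.
exact: subordinate_Hcheb_coef jP sub.
Qed.

(** The product of g(f z) / f z and f z / z is 1 near 0. Passing to quotients lets jets of order 2
    reach the third coefficients, and injectivity keeps f z nonzero off the origin. *)
Lemma inverse_coef f g : classA f -> univalent_U f -> inverse_extension f g ->
  [/\ g 0 = 0, derive1 g 0 = 1, coef2 g = - coef2 f &
      coef3 g = 2 * coef2 f ^+ 2 - coef3 f].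
Proof.
move=> [af [f0 f1]] [_ injf] [[ag _] gf].
have g0 : g 0 = 0 by have := nbhs_singleton gf; rewrite f0.
have fn0 : near0 (fun z => f z != 0).
  exists 1 => // z z0 z1; apply: contraNneq z0 => fz; apply/eqP; apply: injf.
  - by rewrite norm_lt1E.
  - by rewrite normr0.
  - by rewrite fz f0.
have jf := coef_jet af f0 f1; have jq := quotient_coef_jet af f0 f1.
have jg : jet (fun z => g z / z) (derive1 g 0) (coef2 g) (coef3 g).
  by apply: eq_jet (holo0_quotient_jet (analytic_holo0 ag) g0) _
    (erefl _) (erefl _) (erefl _); exists 1.
have jc : jet (fun z => g (f z) / f z) (derive1 g 0) (coef2 g * 1)
    (coef2 g * coef2 f + coef3 g * 1 ^+ 2).
  apply: (jet_comp (g := fun u => g u / u) jg jf).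
  by apply: near0_imp fn0 _ => z _ /eqP.
have : jet (fun=> 1) (derive1 g 0 * 1) (derive1 g 0 * coef2 f + coef2 g * 1 * 1)
    (derive1 g 0 * coef3 f + coef2 g * 1 * coef2 f +
     (coef2 g * coef2 f + coef3 g * 1 ^+ 2) * 1).
  apply: eq_jet (jetM jc jq) _ _ _ _ => //.
  apply: near0_imp (near0_and fn0 (near_near0 gf)) _ => z z0 [fz ->].
  by field; rewrite fz z0.
move=> /(jet_unique (jet_cst 1))[]; clear -g0.
move: (derive1 g 0) (coef2 g) (coef3 g) (coef2 f) (coef3 f) => x b2 b3 a2 a3.
rewrite mulr1 => <- e2 e3.
have b2E : b2 = - a2 by apply: (addrI a2); rewrite subrr [RHS]e2; ring.
by split=> //; apply/eqP; rewrite -subr_eq0; apply/eqP; rewrite [RHS]e3 b2E; ring.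
Qed.

(** Uses |h + k| + |h - k| = 2 max(|h|, k) for k >= 0. *)
Lemma normc_combination (h k : R) (c d : C) : 0 <= k -> nm c <= 1 -> nm d <= 1 ->
  nm ((h + k)%:C%C * c + (h - k)%:C%C * d) <= 2 * Num.max `|h| k.
Proof.
move=> k0 hc hd; apply: (le_trans (le_normcD _ _)).
rewrite !Normc.normcM !normc_real.
have b1 : `|h + k| * nm c <= `|h + k| by rewrite ler_piMr.
have b2 : `|h - k| * nm d <= `|h - k| by rewrite ler_piMr.
apply: le_trans (lerD b1 b2) _; set M := Num.max _ _.
have /andP[hM1 hM2] : - M <= h <= M by rewrite -ler_norml le_max lexx.
have kM : k <= M by rewrite le_max lexx orbT.
by case: (leP 0 (h + k)) => i; [rewrite (ger0_norm i)|rewrite (ltr0_norm i)];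
  case: (leP 0 (h - k)) => j; rewrite ?(ger0_norm j) ?(ltr0_norm j); lra.
Qed.

(* The last two equations are those of the inverse function, whose coefficients
   are [- a2] and [2 a2 ^+ 2 - a3]. *)
Lemma fekete_szego_identity (A B Q D t eta a2 a3 c1 c2 d1 d2 : C) :
  D = A ^+ 2 - 2 * (2 * A ^+ 2 - (2 * B + 2 * Q)) * t ^+ 2 ->
  t != 0 -> B != 0 ->
  A * a2 = 2 * t * c1 -> B * a3 + Q * a2 ^+ 2 = 2 * t * c2 + (4 * t ^+ 2 - 1) * c1 ^+ 2 ->
  A * - a2 = 2 * t * d1 ->
  B * (2 * a2 ^+ 2 - a3) + Q * (- a2) ^+ 2 = 2 * t * d2 + (4 * t ^+ 2 - 1) * d1 ^+ 2 ->
  D * a2 ^+ 2 = 4 * t ^+ 3 * (c2 + d2) /\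
  a3 - eta * a2 ^+ 2 = (1 - eta) * a2 ^+ 2 + t / B * (c2 - d2).
Proof.
move=> DE t0 B0 e1 e2 e3 e4.
have t2 : 2 * t != 0 by rewrite mulf_neq0// pnatr_eq0.
have ed : d1 = - c1 by apply: (mulfI t2); rewrite -e3 mulrN e1; ring.
rewrite ed in e4; split.
  have s : A ^+ 2 * a2 ^+ 2 = 4 * t ^+ 2 * c1 ^+ 2 by rewrite -exprMn e1; ring.
  have q : 2 * (B + Q) * a2 ^+ 2 = 2 * t * (c2 + d2) + 2 * (4 * t ^+ 2 - 1) * c1 ^+ 2.
    have -> : 2 * (B + Q) * a2 ^+ 2 = (B * a3 + Q * a2 ^+ 2) +
       (B * (2 * a2 ^+ 2 - a3) + Q * (- a2) ^+ 2) by ring.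
    by rewrite e2 e4; ring.
  (* D is the combination of A^2 and 2 (B + Q) in which the c1^2 terms of [s] and [q] cancel. *)
  have -> : D * a2 ^+ 2 = (1 - 4 * t ^+ 2) * (A ^+ 2 * a2 ^+ 2) +
      2 * t ^+ 2 * (2 * (B + Q) * a2 ^+ 2) by rewrite DE; ring.
  by rewrite s q; ring.
have two : 2 != 0 :> C by rewrite pnatr_eq0.
have q : 2 * (B * (a3 - a2 ^+ 2)) = 2 * (t * (c2 - d2)).
  have -> : 2 * (B * (a3 - a2 ^+ 2)) = (B * a3 + Q * a2 ^+ 2) -
     (B * (2 * a2 ^+ 2 - a3) + Q * (- a2) ^+ 2) by ring.
  by rewrite e2 e4; ring.
have {}q := mulfI two q.
have -> : t / B * (c2 - d2) = a3 - a2 ^+ 2.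
  by apply: (mulfI B0); rewrite q; field.
by ring.
Qed.

End Main.

Unset Implicit Arguments.

Theorem theorem2 (R : realType) (lam mu del t : R) (f : R[i] -> R[i]) :
  1 <= lam -> 0 <= mu -> 0 <= del -> 2%:R^-1 < t -> t < 1 ->
  classB lam mu del t f ->
  forall eta : R,
    (`|eta - 1| <= Mquant lam mu del t ->
       `|coef3 f - eta%:C%C * coef2 f ^+ 2|
         <= (2%:R * t / (2%:R * lam + mu + 6%:R * xi lam mu * del))%:C%C) /\
    (Dquant lam mu del t != 0 -> Mquant lam mu del t <= `|eta - 1| ->
       `|coef3 f - eta%:C%C * coef2 f ^+ 2|
         <= (8%:R * `|eta - 1| * t ^+ 3 / `|Dquant lam mu del t|)%:C%C).
Proof.
move=> l1 m0 d0 t12 t1 [Af [uf [g [ig [[Lf [lf sf]] [Lg [lg sg]]]]]]] eta.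
have [g0 g1 b2 b3] := inverse_coef Af uf ig.
have [[af [f0 f1]] [[ag _] _]] := (Af, ig).
have [c1 [c2 [nc e1 e2]]] := Phi_coef af f0 f1 lf sf.
have [d1 [d2 [nd e3 e4]]] := Phi_coef ag g0 g1 lg sg.
rewrite b2 in e3; rewrite b2 b3 in e4.
rewrite norm_normc !lecR.
have x0 := xi_ge0 l1 m0; rewrite /Mquant.
set D := Dquant lam mu del t; set x := xi lam mu in x0 e1 e2 e3 e4 *.
set B := 2 * lam + mu + 6 * x * del in e2 e4 *.
set A := lam + mu + 2 * x * del in e1 e3.
set Q := (mu - 1) * (2 * lam + mu) / 2 in e2 e4.
have t0 : 0 < t by lra.
have B0 : 0 < B by rewrite /B; have := mulr_ge0 x0 d0; lra.
(* Here 2 B + 2 Q = (2 lam + mu)(mu + 1) + 12 xi del. *)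
have DE : D = A ^+ 2 - 2 * (2 * A ^+ 2 - (2 * B + 2 * Q)) * t ^+ 2.
  by rewrite /D /Dquant /= -/x /A /B /Q; field.
have DC : D%:C%C = A%:C%C ^+ 2 - 2 * (2 * A%:C%C ^+ 2 - (2 * B%:C%C + 2 * Q%:C%C)) * t%:C%C ^+ 2.
  by rewrite DE; ring.
move: (coef2 f) (coef3 f) e1 e2 e3 e4 => a2 a3 e1 e2 e3 e4.
have [s1 ->] := fekete_szego_identity eta%:C%C DC (real_neq0 t0) (real_neq0 B0) e1 e2 e3 e4.
have k0 : 0 < t / B by rewrite divr_gt0.
have bound : D != 0 -> nm ((1 - eta%:C%C) * a2 ^+ 2 + t%:C%C / B%:C%C * (c2 - d2)) <=
    2 * Num.max (4 * t ^+ 3 * `|eta - 1| / `|D|) (t / B).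
  move=> Dn; pose h := 4 * t ^+ 3 * (1 - eta) / D.
  have DnC : D%:C%C != 0 :> R[i] by apply: contraNneq Dn => /complexI ->.
  have a2E : a2 ^+ 2 = 4 * t%:C%C ^+ 3 * (c2 + d2) / D%:C%C.
    by apply: (mulfI DnC); rewrite s1; field.
  have -> : (1 - eta%:C%C) * a2 ^+ 2 + t%:C%C / B%:C%C * (c2 - d2) =
      (h + t / B)%:C%C * c2 + (h - t / B)%:C%C * d2.
    by rewrite a2E /h; field; rewrite DnC (real_neq0 B0).
  have -> : 4 * t ^+ 3 * `|eta - 1| / `|D| = `|h|.
    by rewrite /h normf_div (normrM _ (1 - eta)) (normrM 4) normrX (gtr0_norm t0) normr_nat (distrC 1).
  exact: normc_combination (ltW k0) nc nd.
(* That is |h| = k |eta - 1| / M, so comparing |eta - 1| with M decides which term is the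
   maximum. *)
have cmp : D != 0 -> 4 * t ^+ 3 * `|eta - 1| / `|D| = t / B * (`|eta - 1| / (`|D| / (4 * B * t ^+ 2))).
  by move=> Dn; field; rewrite normr_eq0 Dn !lt0r_neq0.
have M0 : D != 0 -> 0 < `|D| / (4 * B * t ^+ 2).
  by move=> Dn; rewrite divr_gt0 ?normr_gt0// !mulr_gt0// exprn_gt0.
split=> [|Dn] hM.
  (* For D = 0 the division in [Mquant] gives M = 0, hence eta = 1, and only (t / B)(c2 - d2) is
     left to bound. *)
  have [D0|Dn] := eqVneq D 0; last first.
    have -> : 2 * t / B = 2 * (t / B) by rewrite mulrA.
    apply: le_trans (bound Dn) _; rewrite ler_pM2l// ge_max lexx andbT cmp//.
    by rewrite ler_piMr ?(ltW k0)// ler_pdivrMr ?M0// mul1r.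
  move: hM; rewrite D0 normr0 mul0r normr_le0 subr_eq0 => /eqP ->.
  rewrite subrr mul0r add0r Normc.normcM -fmorph_div normc_real gtr0_norm//.
  have := le_normcD c2 (- d2); rewrite normcN => hcd.
  have -> : 2 * t / B = t / B * 2 by field; rewrite lt0r_neq0.
  by rewrite ler_wpM2l ?(ltW k0)//; lra.
have -> : 8 * `|eta - 1| * t ^+ 3 / `|D| = 2 * (4 * t ^+ 3 * `|eta - 1| / `|D|).
  by field; rewrite normr_eq0.
apply: le_trans (bound Dn) _; rewrite ler_pM2l// ge_max lexx /= cmp//.
by rewrite ler_peMr ?(ltW k0)// ler_pdivlMr ?M0// mul1r.
Qed.
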